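(* Let $\Phi(E_8)$ be the set of $240$ norm-one elements of the Coxeter--Dickson lattice $\mathbb{O}_{E_8}$. The set of para-octonionic idempotents in it is $$\{x\in\Phi(E_8): x\bullet x=x\}=\{1\}\sqcup\{x\in\Phi(E_8):\langle x,1\rangle=-1\},$$ and it has exactly $57=1+56$ elements. Relative to the root $\alpha=1$, the $240$ roots are distributed according to the values $2,1,0,-1,-2$ of the inner product with $\alpha$ as $$240=1+56+126+56+1,$$ and the $126$ roots orthogonal to $\alpha$ form a root system of type $E_7$. The corresponding decomposition of the complex Lie algebra $\mathfrak{e}_8$, graded by the inner product of roots with $\alpha$ (Cartan subalgebra in degree $0$), is the contact $5$-grading $$\mathfrak{e}_8=\mathbf{1}_{-2}\oplus\mathbf{56}_{-1}\oplus(\mathfrak{e}_7\oplus\mathbb{C})_0\oplus\mathbf{56}_{+1}\oplus\mathbf{1}_{+2},$$ where $\mathbf{56}$ is the minuscule $56$-dimensional representation of $\mathfrak{e}_7$. Reducing degrees modulo $3$ gives a $\mathbb{Z}/3$-grading $\mathfrak{e}_8=\mathcal{G}_0\oplus\mathcal{G}_1\oplus\mathcal{G}_2$ with $\mathcal{G}_0=\mathfrak{e}_7\oplus\mathbb{C}$, $\mathcal{G}_1=\mathbf{56}_{+1}\oplus\mathbf{1}_{-2}$, $\mathcal{G}_2=\mathbf{56}_{-1}\oplus\mathbf{1}_{+2}$, and each of $\mathcal{G}_1$, $\mathcal{G}_2$ contains exactly $57$ root spaces.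
   Context: Octonions. $\mathbb{O}$ is the real division algebra of octonions with unit $1$ and basis $1,\mathrm{i},\mathrm{j},\mathrm{k},\mathrm{l},\mathrm{il},\mathrm{jl},\mathrm{kl}$; each imaginary basis unit squares to $-1$, distinct imaginary basis units anticommute, and the remaining products are given by the oriented triples $(\mathrm{i},\mathrm{j},\mathrm{k})$, $(\mathrm{i},\mathrm{l},\mathrm{il})$, $(\mathrm{j},\mathrm{l},\mathrm{jl})$, $(\mathrm{k},\mathrm{l},\mathrm{kl})$, $(\mathrm{jl},\mathrm{i},\mathrm{kl})$, $(\mathrm{kl},\mathrm{j},\mathrm{il})$, $(\mathrm{il},\mathrm{k},\mathrm{jl})$, where $(x,y,z)$ means $xy=z$, $yz=x$, $zx=y$. $\bar x$ is octonionic conjugation, $n(x)=x\bar x$ is the composition norm, and $\langle x,y\rangle=x\bar y+y\bar x=2\operatorname{Re}(x\bar y)$, so $\langle x,x\rangle=2n(x)$. The para-octonionic product is $x\bullet y=\bar x\cdot\bar y$. Lattice. $\mathbb{O}_{E_8}$ is the $\mathbb{Z}$-span of $1,\mathrm{i},\mathrm{j},\mathrm{k},\mathrm{h},\mathrm{i}\mathrm{h},\mathrm{j}\mathrm{h},\mathrm{k}\mathrm{h}$, where $\mathrm{h}=\tfrac12(\mathrm{i}+\mathrm{j}+\mathrm{k}+\mathrm{l})$. It is closed under conjugation and octonionic multiplication; with $\langle\cdot,\cdot\rangle$ it is an $E_8$ lattice, and its $240$ elements with $n(x)=1$ form the root system $\Phi(E_8)$ (squared length $2$). The complex Lie algebra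 $\mathfrak{e}_8$ is taken with Cartan subalgebra and root system identified with $\Phi(E_8)$. Subscripts denote degrees. *)

(* Defs.v *)
From HB Require Import structures.
From mathcomp Require Import all_boot all_order all_algebra.
From mathcomp Require Import boolp classical_sets functions cardinality fsbigop.
From mathcomp Require Import reals.
From mathcomp Require Import complex.

Set Implicit Arguments.
Unset Strict Implicit.
Unset Printing Implicit Defensive.

Import Order.TTheory GRing.Theory Num.Theory.

Local Open Scope classical_set_scope.
Local Open Scope ring_scope.

(* Coordinates 0, ..., 7 are along 1, i, j, k, l, il, jl, kl. *)
Notation octonion R := 'rV[R]_8.

Definition oct_triples : seq (nat * nat * nat) :=
  [:: (1, 2, 3); (1, 4, 5); (2, 4, 6); (3, 4, 7); (6, 1, 7); (7, 2, 5);
      (5, 3, 6)]%N.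

Definition oct_oriented (x y z : nat) : bool :=
  [|| (x, y, z) \in oct_triples, (y, z, x) \in oct_triples
    | (z, x, y) \in oct_triples].

Section Octonions.
Variable R : realType.
Implicit Types x y : octonion R.

Definition oct_unit (m : nat) : octonion R :=
  \row_(p < 8) ((p : nat) == m)%:R.

Definition oct_one : octonion R := oct_unit 0.

(* Coordinate of e_p e_q along e_m, where e_0, ..., e_7 are the basis units. *)
Definition oct_coef (p q m : nat) : R :=
  if p == 0%N then (q == m)%:R
  else if q == 0%N then (p == m)%:R
  else if p == q then - (m == 0%N)%:R
  else (oct_oriented p q m)%:R - (oct_oriented q p m)%:R.

Definition oct_mul x y : octonion R :=
  \row_(m < 8) \sum_(p < 8) \sum_(q < 8) x 0 p * y 0 q * oct_coef p q m.

Definition oct_conj x : octonion R :=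
  \row_(m < 8) if (m : nat) == 0%N then x 0 m else - x 0 m.

Definition oct_re x : R := x 0 ord0.

(* x * oct_conj x is real, so n(x) is its real part. *)
Definition oct_norm x : R := oct_re (oct_mul x (oct_conj x)).

Definition oct_inner x y : R := 2 * oct_re (oct_mul x (oct_conj y)).

Definition oct_para x y : octonion R := oct_mul (oct_conj x) (oct_conj y).

Definition oct_h : octonion R :=
  2^-1 *: (oct_unit 1 + oct_unit 2 + oct_unit 3 + oct_unit 4).

Definition E8_gens : seq (octonion R) :=
  [:: oct_one; oct_unit 1; oct_unit 2; oct_unit 3;
      oct_h; oct_mul (oct_unit 1) oct_h; oct_mul (oct_unit 2) oct_h;
      oct_mul (oct_unit 3) oct_h].

Definition E8_lattice : set (octonion R) :=
  [set x | exists c : 'I_8 -> int, x = \sum_(p < 8) E8_gens`_p *~ c p].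

Definition E8_roots : set (octonion R) :=
  E8_lattice `&` [set x | oct_norm x = 1].

(* <x, a^vee> for the Euclidean structure oct_inner *)
Definition oct_pairing x (a : octonion R) : R :=
  2 * oct_inner x a / oct_inner a a.

End Octonions.

Arguments oct_unit R m : clear implicits.
Arguments oct_one R : clear implicits.
Arguments oct_h R : clear implicits.
Arguments E8_gens R : clear implicits.
Arguments E8_lattice R : clear implicits.
Arguments E8_roots R : clear implicits.

Section RootSystems.
Variables (K : numFieldType) (V : vectType K).

(* Reduced root system in the span of Psi; pair x a is the value at x of the
   coroot of a. *)
Definition root_system (Psi : set V) (pair : V -> V -> K) : Prop :=
  [/\ finite_set Psi /\ ~ Psi 0,
      forall a, Psi a -> scalar (pair^~ a) /\ pair a a = 2,
      forall a b, Psi a -> Psi b -> Psi (b - pair b a *: a),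
      forall a b, Psi a -> Psi b -> exists m : int, pair b a = m%:~R
    & forall a (c : K), Psi a -> Psi (c *: a) -> c = 1 \/ c = -1].

Definition root_base n (Psi : set V) (d : n.-tuple V) : Prop :=
  [/\ free d, forall p : 'I_n, Psi (tnth d p)
    & forall b, Psi b -> exists c : 'I_n -> nat,
        b = \sum_(p < n) tnth d p *+ c p \/
        b = - \sum_(p < n) tnth d p *+ c p].

Definition root_system_of_type n (A : 'M[int]_n) (Psi : set V)
    (pair : V -> V -> K) : Prop :=
  root_system Psi pair /\
  exists d : n.-tuple V, root_base Psi d /\
    forall p q : 'I_n, pair (tnth d p) (tnth d q) = (A p q)%:~R.

(* Orbits of the group generated by the reflections in the roots. *)
Inductive weyl_conjugate (Psi : set V) (pair : V -> V -> K) (x : V)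
    : V -> Prop :=
| weyl_refl : weyl_conjugate Psi pair x x
| weyl_step (a y : V) : Psi a -> weyl_conjugate Psi pair x y ->
    weyl_conjugate Psi pair x (y - pair y a *: a).

End RootSystems.

(* Bourbaki's numbering, shifted to start from 0. *)
Definition E7_edges : seq (nat * nat) :=
  [:: (0, 2); (2, 3); (3, 4); (4, 5); (5, 6); (1, 3)]%N.

Definition E7_cartan : 'M[int]_7 :=
  \matrix_(p, q)
    if p == q then 2
    else if ((p : nat, q : nat) \in E7_edges) || ((q : nat, p : nat) \in E7_edges)
    then -1 else 0.

HB.mixin Record Vector_isLie (K : fieldType) (L : Type) of Vector K L := {
  lie : L -> L -> L;
  lie_linearl : forall y, linear (lie^~ y);
  lie_linearr : forall x, linear (lie x);
  liexx : forall x, lie x x = 0;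
  lie_jacobi : forall x y z,
    lie x (lie y z) + lie y (lie z x) + lie z (lie x y) = 0
}.

#[short(type="lieAlgType")]
HB.structure Definition LieAlgebra (K : fieldType) :=
  {L of Vector_isLie K L & Vector K L}.

Section LieAlgebras.
Variables (K : fieldType) (L : lieAlgType K).
Implicit Types S T M U V W : {vspace L}.
Implicit Types x y z : L.

HB.instance Definition _ (x : L) :=
  GRing.isLinear.Build K L L *:%R (lie x) (lie_linearr x).

Lemma lieDl x y z : lie (x + y) z = lie x z + lie y z.
Proof. by have := lie_linearl z 1 x y; rewrite /= !scale1r. Qed.

Lemma lie0l z : lie 0 z = 0.
Proof. by apply: (addrI (lie 0 z)); rewrite -lieDl !addr0. Qed.

Lemma lieZl (c : K) x z : lie (c *: x) z = c *: lie x z.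
Proof. by have := lie_linearl z c x 0; rewrite /= lie0l !addr0. Qed.

Lemma lie_suml (I : finType) (F : I -> L) z :
  lie (\sum_i F i) z = \sum_i lie (F i) z.
Proof.
by apply: (big_morph (fun y => lie y z)) => [x y|]; rewrite ?lieDl ?lie0l.
Qed.

Definition ad (x : L) : 'End(L) := linfun (lie x).

Lemma adE x y : ad x y = lie x y.
Proof. by rewrite lfunE. Qed.

Definition bracket_in U V W : Prop :=
  forall x y, x \in U -> y \in V -> lie x y \in W.

Definition simple_subalgebra S : Prop :=
  [/\ bracket_in S S S, ~ bracket_in S S 0%VS
    & forall I : {vspace L}, (I <= S)%VS -> bracket_in S I I ->
        I = 0%VS \/ I = S].

Definition ad_diagonalizable S (h : L) : Prop :=
  exists2 X : seq L, basis_of S X &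
    {in X, forall x, exists a : K, lie h x = a *: x}.

(* Cartan subalgebras of semisimple S: maximal abelian, consisting of
   ad-diagonalizable elements. *)
Definition cartan_subalgebra S T : Prop :=
  [/\ (T <= S)%VS, bracket_in T T 0%VS,
      forall x, x \in S -> (forall h, h \in T -> lie h x = 0) -> x \in T
    & forall h, h \in T -> ad_diagonalizable S h].

Definition dual_space T := 'Hom(subvs_of T, K^o).

Definition weight_space T M (mu : dual_space T) : {vspace L} :=
  (M :&: \bigcap_(p < \dim {:subvs_of T})
     let h := (vbasis {:subvs_of T})`_p in
     lker (ad (vsval h) - (mu h : K) *: \1%VF))%VS.

Lemma mem_weight_space T M (mu : dual_space T) x :
  x \in weight_space M mu <->
  x \in M /\ forall h : subvs_of T, lie (vsval h) x = (mu h : K) *: x.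
Proof.
split=> [|[xM xmu]]; last first.
  rewrite memv_cap xM memvE; apply/subv_bigcapP => p _.
  rewrite -memvE memv_ker; apply/eqP.
  by rewrite add_lfunE opp_lfunE scale_lfunE id_lfunE adE xmu subrr.
rewrite memv_cap => /andP[xM]; rewrite memvE => /subv_bigcapP xb; split=> // h.
rewrite (coord_vbasis (memvf h)) !linear_sum /=.
rewrite lie_suml scaler_suml; apply: eq_bigr => p _.
have := xb p isT; rewrite -memvE memv_ker add_lfunE opp_lfunE scale_lfunE.
rewrite id_lfunE adE subr_eq0 => /eqP e.
by rewrite !linearZ /= lieZl e scalerA.
Qed.

Definition weights T M : set (dual_space T) :=
  [set mu | weight_space M mu != 0%VS].

Definition root_set S T : set (dual_space T) :=
  [set a | a != 0 /\ weight_space S a != 0%VS].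

Arguments weights : clear implicits.
Arguments root_set : clear implicits.

Definition irreducible_module S M : Prop :=
  [/\ M != 0%VS, bracket_in S M M
    & forall N : {vspace L}, (N <= M)%VS -> bracket_in S N N ->
        N = 0%VS \/ N = M].

(* directv is sensitive to the syntax of its argument; here the summands are
   variables, so that only the outermost sum is asserted to be direct. *)
Definition direct_sum2 W U V : Prop := W = (U + V)%VS /\ directv (U + V).

Definition direct_sum (I : finType) W (F : I -> {vspace L}) : Prop :=
  W = (\sum_i F i)%VS /\ directv (\sum_i F i).

Definition graded_by (g : int -> {vspace L}) : Prop :=
  forall p q : int, bracket_in (g p) (g q) (g (p + q)).

Definition five_grading (g : int -> {vspace L}) : Prop :=
  [/\ graded_by g,
      forall p : int, 2 < `|p| -> g p = 0%VS
    & direct_sum fullv (fun p : 'I_5 => g (p%:Z - 2))].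

Definition contact_grading (g : int -> {vspace L}) : Prop :=
  [/\ five_grading g, \dim (g (- 2)) = 1%N
    & forall x, x \in g (- 1) ->
        (forall y, y \in g (- 1) -> lie x y = 0) -> x = 0].

(* Degrees of a 5-grading, -2, ..., 2, reduced modulo 3. *)
Definition mod3_component (g : int -> {vspace L}) (r : 'Z_3) : {vspace L} :=
  (\sum_(p < 5 | ((p%:Z - 2)%:~R == r)%R) g (p%:Z - 2)%R)%VS.

Definition root_spaces_in T (W : {vspace L}) : set {vspace L} :=
  [set U | (U <= W)%VS /\
           exists2 a : dual_space T, root_set fullv T a & U = weight_space fullv a].

End LieAlgebras.

Arguments weights {K L} T M _.
Arguments root_set {K L} S T _.

Section LieTypes.
Variables (K : numFieldType) (L : lieAlgType K).
Implicit Types S T M : {vspace L}.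

Definition simple_of_type n (A : 'M[int]_n) S T
    (pair : dual_space T -> dual_space T -> K) : Prop :=
  [/\ simple_subalgebra S, cartan_subalgebra S T
    & root_system_of_type A (root_set S T) pair].

Definition minuscule_module S T (pair : dual_space T -> dual_space T -> K) M : Prop :=
  irreducible_module S M /\
  exists mu : dual_space T, forall nu : dual_space T,
    weights T M nu <-> weyl_conjugate (root_set S T) pair mu nu.

End LieTypes.

Section E8.
Variables (R : realType) (L : lieAlgType R[i]) (H : {vspace L}).

(* rho is an isomorphism of root systems from Phi(E8) onto the roots of
   (L, H). *)
Definition E8_identification (rho : octonion R -> dual_space H) : Prop :=
  [/\ forall (c : R) x y, rho (c *: x + y) = c%:C%C *: rho x + rho y,
      injective rho
    & rho @` E8_roots R = root_set fullv H].

Definition e8_with_roots (rho : octonion R -> dual_space H) : Prop :=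
  [/\ simple_subalgebra (fullv : {vspace L}), cartan_subalgebra fullv H
    & E8_identification rho].

Definition e8_component (rho : octonion R -> dual_space H) (alpha : octonion R)
    (p : int) : {vspace L} :=
  ((if (p == 0)%R then H else 0) +
   \big[addv/0%VS]_(b \in E8_roots R `&` [set b | oct_inner b alpha = p%:~R])
      weight_space fullv (rho b))%VS.

End E8.

(* Main.v *)
Require Import Defs.
From HB Require Import structures.
From mathcomp Require Import all_boot all_order all_algebra.
From mathcomp Require Import boolp classical_sets functions cardinality fsbigop.
From mathcomp Require Import reals.
From mathcomp Require Import complex.
From mathcomp Require Import ring lra zify.

Set Implicit Arguments.
Unset Strict Implicit.
Unset Printing Implicit Defensive.

Import Order.TTheory GRing.Theory Num.Theory.

Local Open Scope classical_set_scope.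
Local Open Scope card_scope.
Local Open Scope ring_scope.

(** Roots are handled through their doubled coordinates: x = y / 2 is in the lattice
exactly when the integer vector y reduces modulo 2 into the extended Hamming code
([E8_latticeP]), so that the roots are the 240 such y of square norm 4, and the inner
product with 1 is the coordinate y_0. The idempotents come from the quadratic equation
x^2 = 2 Re(x) x - n(x) ([oct_sqr]). Apart from counting, the E8 combinatorics reduces
to one fact: the inner product of two roots is an integer between -2 and 2, and a + b
is a root exactly when it is -1 ([E8_inner_values], [E8_rootD]). Connectedness of the
E7 diagram and of the Gosset graph on the 56 roots of level 1 or -1 is stated as an
induction principle ([E7_connected], [gosset_connected]).

For the Lie algebra, let W x be the space of weight rho x, with W 0 = H. Simultaneous
diagonalization shows that the whole algebra is the direct sum of the W b, and the root
string of b in a direction a other than b and - b has length at most two. Evaluating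
t = [u, v] on such strings, for u in W a and v in W (- a), gives 2 b(t) = <b, a> a(t)
for all roots b ([wt_lie]); so t = 0 as soon as a(t) = 0. If a(t) <> 0, then u and v
span with t a copy of sl2, W a is a line, and the bracket of W a and W b is not 0
whenever a + b is a root. The root spaces for which all the t vanish span an ideal that
misses H, so by simplicity there are none ([sl2_pair_exists]). This yields the coroots,
which span H ([H_coroots]), and all brackets between root spaces up to nonzero factors.

Every piece of the gradings is then a sum of spaces W b over a set of weights, so that
directness, dimensions and bracket inclusions are statements about degrees. The
subalgebra e7 is the centralizer of W 1 in degree 0. A subspace stable under its torus
contains the components of its elements ([stable_components]), because distinct weights
of the same degree have distinct restrictions; an ideal or a submodule that is not 0
thus contains a root space, and connectedness gives the rest. *)

(** * Arithmetic of the octonions *)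

Section OctonionArithmetic.
Variable R : realType.
Implicit Types x y z : octonion R.

Lemma oct_coef0 (p q : nat) :
  oct_coef R p q 0 = (-1) ^+ (p != 0%N) *+ (p == q).
Proof.
rewrite /oct_coef; case: (eqVneq p 0%N) => [->|p0] /=.
  by rewrite expr0 eq_sym; case: eqP.
case: (eqVneq q 0%N) => [->|q0]; first by rewrite (negPf p0).
case: (eqVneq p q) => [_|_]; first by rewrite expr1.
by rewrite /oct_oriented !inE !xpair_eqE /= !andbF !andFb subrr.
Qed.

(** Distinct imaginary units anticommute, so symmetrizing the structure constants
leaves the products by 1 and the squares; the oriented triples cancel. *)
Lemma oct_coef_sym (p q m : nat) :
  oct_coef R p q m + oct_coef R q p m =
  2 * ((p == 0) && (q == m))%:R + 2 * ((q == 0) && (p == m))%:R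
  - 2 * ((p == q) && (m == 0))%:R.
Proof.
rewrite /oct_coef (eq_sym q p).
case: (eqVneq p 0%N) => [->|p0]; case: (eqVneq q 0%N) => [->|q0] /=.
- by rewrite eq_sym; case: (m == 0)%N => /=; ring.
- by case: (q == m) => /=; ring.
- by rewrite (negPf p0); case: (p == m) => /=; ring.
case: (eqVneq p q) => [_|_] /=; last by ring.
by case: (m == 0)%N => /=; ring.
Qed.

Lemma oct_innerE x y : oct_inner x y = 2 * \sum_(p < 8) x 0 p * y 0 p.
Proof.
rewrite /oct_inner /oct_re mxE; congr (_ * _); apply: eq_bigr => p _.
rewrite (bigD1 p) //= big1 ?addr0 => [|q qp]; rewrite oct_coef0 mxE.
  by rewrite eqxx mulr1n; case: eqP => _; rewrite /= ?expr1 ?expr0; ring.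
have /negPf -> : (p != q :> nat) by rewrite eq_sym.
by rewrite mulr0n mulr0.
Qed.

Lemma oct_normE x : oct_norm x = \sum_(p < 8) x 0 p ^+ 2.
Proof.
have : 2 * oct_norm x = oct_inner x x by [].
by rewrite oct_innerE => /(mulfI (_ : 2 != 0)) -> //; rewrite ?pnatr_eq0.
Qed.

Lemma oct_inner_norm x : oct_inner x x = 2 * oct_norm x.
Proof. by []. Qed.

Lemma oct_innerC x y : oct_inner x y = oct_inner y x.
Proof.
by rewrite !oct_innerE; congr (_ * _); apply: eq_bigr => p _; rewrite mulrC.
Qed.

Lemma oct_inner_scalar y : scalar (@oct_inner R ^~ y).
Proof.
move=> c x z; rewrite !oct_innerE mulrCA -mulrDr; congr (_ * _).
rewrite mulr_sumr -big_split /=; apply: eq_bigr => p _.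
by rewrite !mxE mulrDl mulrA.
Qed.

Lemma oct_innerDl x y z : oct_inner (x + y) z = oct_inner x z + oct_inner y z.
Proof. by have := oct_inner_scalar z 1 x y; rewrite scale1r mul1r. Qed.

Lemma oct_inner0l z : oct_inner 0 z = 0.
Proof. by apply: (addrI (oct_inner 0 z)); rewrite -oct_innerDl !addr0. Qed.

Lemma oct_innerZl c x z : oct_inner (c *: x) z = c * oct_inner x z.
Proof. by have := oct_inner_scalar z c x 0; rewrite oct_inner0l !addr0. Qed.

Lemma oct_innerNl x z : oct_inner (- x) z = - oct_inner x z.
Proof. by rewrite -scaleN1r oct_innerZl mulN1r. Qed.

Lemma oct_innerBl x y z : oct_inner (x - y) z = oct_inner x z - oct_inner y z.
Proof. by rewrite oct_innerDl oct_innerNl. Qed.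

Lemma oct_innerDr x y z : oct_inner z (x + y) = oct_inner z x + oct_inner z y.
Proof. by rewrite !(oct_innerC z) oct_innerDl. Qed.

Lemma oct_innerBr x y z : oct_inner z (x - y) = oct_inner z x - oct_inner z y.
Proof. by rewrite !(oct_innerC z) oct_innerBl. Qed.

Lemma oct_innerNr x z : oct_inner z (- x) = - oct_inner z x.
Proof. by rewrite !(oct_innerC z) oct_innerNl. Qed.

Lemma oct_innerZr c x z : oct_inner z (c *: x) = c * oct_inner z x.
Proof. by rewrite !(oct_innerC z) oct_innerZl. Qed.

Lemma oct_norm_ge0 x : 0 <= oct_norm x.
Proof. by rewrite oct_normE sumr_ge0 // => p _; rewrite sqr_ge0. Qed.

Lemma oct_norm_eq0 x : oct_norm x = 0 -> x = 0.
Proof.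
rewrite oct_normE => /eqP; rewrite psumr_eq0 => [/allP x0|p _]; last first.
  by rewrite sqr_ge0.
apply/rowP => p; rewrite mxE; apply/eqP.
by have := x0 p (mem_index_enum _); rewrite sqrf_eq0.
Qed.

Lemma oct_normD x y : oct_norm (x + y) = oct_norm x + oct_norm y + oct_inner x y.
Proof.
rewrite !oct_normE oct_innerE mulr_sumr -!big_split /=.
by apply: eq_bigr => p _; rewrite mxE; ring.
Qed.

Lemma oct_normN x : oct_norm (- x) = oct_norm x.
Proof. by rewrite !oct_normE; apply: eq_bigr => p _; rewrite mxE sqrrN. Qed.

Lemma oct_normB x y : oct_norm (x - y) = oct_norm x + oct_norm y - oct_inner x y.
Proof. by rewrite oct_normD oct_normN oct_innerNr. Qed.

(** A coordinate of x^2 is a quadratic form in x, so it only depends on the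
symmetrized structure constants. *)
Lemma oct_sqr x : oct_mul x x = (2 * oct_re x) *: x - oct_norm x *: oct_one R.
Proof.
apply/rowP => m; rewrite !mxE.
set S := LHS.
have S2 : S + S = \sum_(p < 8) \sum_(q < 8)
    x 0 p * x 0 q * (oct_coef R p q m + oct_coef R q p m).
  rewrite {2}/S exchange_big -big_split /=; apply: eq_bigr => p _.
  by rewrite -big_split /=; apply: eq_bigr => q _; rewrite mulrDr (mulrC (x 0 q)).
suff : S + S = 2 * (2 * oct_re x * x 0 m - oct_norm x * ((m : nat) == 0)%:R).
  move=> e; apply: (mulfI (_ : 2 != 0 :> R)); first by rewrite pnatr_eq0.
  by rewrite -e; ring.
rewrite S2.
under eq_bigr => p _ do under eq_bigr => q _ do
  rewrite oct_coef_sym mulrBr mulrDr.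
have delta2 (i j : 'I_8) (b : bool) :
    \sum_(p < 8) \sum_(q < 8) x 0 p * x 0 q * (2 * ((p == i) && (q == j))%:R)
    = 2 * x 0 i * x 0 j.
  rewrite (bigD1 i) //= [X in _ + X]big1 ?addr0 => [|p /negPf pi]; last first.
    by rewrite big1 // => q _; rewrite pi !mulr0.
  rewrite (bigD1 j) //= [X in _ + X]big1 ?addr0 => [|q /negPf qj].
    by rewrite !eqxx /=; ring.
  by rewrite qj andbF !mulr0.
under eq_bigr => p _ do rewrite sumrB big_split /=.
rewrite sumrB big_split /=.
have -> := delta2 ord0 m true.
have -> : \sum_(p < 8) \sum_(q < 8) x 0 p * x 0 q *
    (2 * ((q == 0 :> nat) && (p == m :> nat))%:R) = 2 * x 0 ord0 * x 0 m.
  rewrite exchange_big /= -(delta2 ord0 m true).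
  by apply: eq_bigr => p _; apply: eq_bigr => q _; rewrite (mulrC (x 0 q)).
have -> : \sum_(p < 8) \sum_(q < 8) x 0 p * x 0 q *
    (2 * ((p == q :> nat) && (m == 0 :> nat))%:R)
    = 2 * oct_norm x * (m == 0 :> nat)%:R.
  rewrite oct_normE mulr_sumr mulr_suml; apply: eq_bigr => p _.
  rewrite (bigD1 p) //= eqxx [X in _ + X]big1 ?addr0 => [|q qp]; first by ring.
  by rewrite eq_sym [_ == _](negPf qp) !mulr0.
by rewrite /oct_re /=; ring.
Qed.

End OctonionArithmetic.

(** * The lattice in doubled coordinates *)

Definition dotz (y z : seq int) : int :=
  foldr (fun u s => u.1 * u.2 + s) 0 (zip y z).

(** The parity checks of the extended Hamming code of length 8. *)
Definition hamming (y : seq int) : bool :=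
  [&& 2 %| y`_0 + y`_5 + y`_6 + y`_7, 2 %| y`_1 + y`_4 + y`_6 + y`_7,
      2 %| y`_2 + y`_4 + y`_5 + y`_7 & 2 %| y`_3 + y`_4 + y`_5 + y`_6]%Z.

(** All integers v with v^2 <= k, as long as k <= 8. *)
Definition short_ints (k : nat) : seq int :=
  [seq v <- [:: -2; -1; 0; 1; 2] | (`|v| ^ 2 <= k)%N].

Fixpoint sq_vectors (n k : nat) : seq (seq int) :=
  if n is n'.+1 then
    flatten [seq [seq v :: y | y <- sq_vectors n' (k - `|v| ^ 2)]
            | v <- short_ints k]
  else if k == 0%N then [:: [::]] else [::].

Definition rootz : seq (seq int) := [seq y <- sq_vectors 8 4 | hamming y].

Lemma rootz_uniq : uniq rootz.
Proof. by vm_compute. Qed.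

Lemma sqz_abs (v : int) : v * v = (`|v| ^ 2)%N.
Proof.
by rewrite -mulnn PoszM abszE -normrM ger0_norm // -expr2 sqr_ge0.
Qed.

Lemma mem_short_ints k v : (k <= 8)%N ->
  (v \in short_ints k) = (`|v| ^ 2 <= k)%N.
Proof.
move=> k8; rewrite mem_filter andb_idr // => vk.
have : (`|v| < 3)%N.
  rewrite ltnNge; apply/negP => v3.
  by have := leq_trans (leq_mul v3 v3) (leq_trans vk k8).
by case: v {vk} => -[|[|[|n]]].
Qed.

(** The bound on k comes from the entries in short_ints. *)
Lemma mem_sq_vectors n k y : (k <= 8)%N ->
  (y \in sq_vectors n k) = (size y == n) && (dotz y y == k%:Z).
Proof.
elim: n k y => [|n IHn] k y k8.
  by case: y => [|v y] /=; case: k k8.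
have dot_cons v z : dotz (v :: z) (v :: z) = v * v + dotz z z by [].
apply/flattenP/idP => [[s /mapP[v]]|].
  rewrite mem_short_ints // => vk -> /mapP[z].
  rewrite IHn; last exact: leq_trans (leq_subr _ _) k8.
  move=> /andP[/eqP sz /eqP zz] ->; rewrite /= sz eqxx /=.
  by rewrite dot_cons zz sqz_abs -subzn // addrC subrK.
case: y => [|v y] //; rewrite dot_cons /= eqSS => /andP[sy /eqP yk].
have y_ge0 : 0 <= dotz y y.
  elim: (y) => [|u z IHz] //; rewrite dot_cons addr_ge0 //.
  by rewrite -expr2 sqr_ge0.
have vk : (`|v| ^ 2 <= k)%N.
  by rewrite -lez_nat -yk sqz_abs lerDl.
exists [seq v :: z | z <- sq_vectors n (k - `|v| ^ 2)].
  by apply: map_f; rewrite mem_short_ints.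
apply: map_f; rewrite IHn; last exact: leq_trans (leq_subr _ _) k8.
by rewrite sy /= -subzn // -yk -sqz_abs addrC addKr.
Qed.

Section Lattice.
Variable R : realType.

(** The point whose doubled coordinates are y. *)
Definition half_vec (y : seq int) : octonion R := \row_(p < 8) ((y`_p)%:~R / 2).

Definition half_gens : seq (seq int) :=
  [:: [:: 2; 0; 0; 0; 0; 0; 0; 0]; [:: 0; 2; 0; 0; 0; 0; 0; 0];
      [:: 0; 0; 2; 0; 0; 0; 0; 0]; [:: 0; 0; 0; 2; 0; 0; 0; 0];
      [:: 0; 1; 1; 1; 1; 0; 0; 0]; [:: -1; 0; -1; 1; 0; 1; 0; 0];
      [:: -1; 1; 0; -1; 0; 0; 1; 0]; [:: -1; -1; 1; 0; 0; 0; 0; 1]].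

Lemma oct_mul_unitl (i : 'I_8) (x : octonion R) (m : 'I_8) :
  oct_mul (oct_unit R i) x 0 m = \sum_(q < 8) x 0 q * oct_coef R i q m.
Proof.
rewrite mxE (bigD1 i) //= [X in _ + X]big1 ?addr0 => [|p pi].
  by apply: eq_bigr => q _; rewrite mxE eqxx mul1r.
by apply: big1 => q _; rewrite mxE [_ == _](negPf pi) !mul0r.
Qed.

Definition oct_coefz (p q m : nat) : int :=
  if p == 0%N then (q == m)%:Z
  else if q == 0%N then (p == m)%:Z
  else if p == q then - (m == 0%N)%:Z
  else (oct_oriented p q m)%:Z - (oct_oriented q p m)%:Z.

Lemma oct_coefzE p q m : oct_coef R p q m = (oct_coefz p q m)%:~R.
Proof.
rewrite /oct_coef /oct_coefz.
by do 3 (case: ifP => _; first by rewrite ?mulrNz -?pmulrn); rewrite mulrzBr -!pmulrn.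
Qed.

(** The products of i, j, k with h are computed from the structure constants, read
as integers. *)
Lemma E8_gensE (p : 'I_8) : (E8_gens R)`_p = half_vec (nth [::] half_gens p).
Proof.
have nz2 : 2 != 0 :> R by rewrite pnatr_eq0.
have unitE (i : nat) y : (i < 8)%N -> y = nseq i 0 ++ 2 :: nseq (7 - i) (0 : int) ->
    oct_unit R i = half_vec y.
  move=> i8 ->; apply/rowP => m; rewrite !mxE nth_cat size_nseq nth_nseq.
  case: ltngtP => [mi|im|->]; first by rewrite mul0r.
    rewrite -(subnSK im) /= nth_nseq; case: ifP; by rewrite mul0r.
  by rewrite subnn /= divff.
have hE : oct_h R = half_vec (nth [::] half_gens 4).
  apply/rowP => -[m lt_m]; rewrite !mxE /=.
  by do 8 (destruct m as [|m]; [by rewrite /=; field|]).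
have mulE (i : 'I_8) y : (forall m : 'I_8, \sum_(q <- iota 0 8)
      (nth [::] half_gens 4)`_q * oct_coefz i q m = y`_m) ->
    oct_mul (oct_unit R i) (oct_h R) = half_vec y.
  move=> yE; apply/rowP => m; rewrite oct_mul_unitl hE mxE -yE.
  rewrite -[iota 0 8]/(index_iota 0 8) big_mkord mulrz_sumr mulr_suml.
  by apply: eq_bigr => q _; rewrite mxE oct_coefzE intrM; field.
case: p => -[|[|[|[|[|[|[|[|//]]]]]]]] lt_p /=;
  do ?[exact: hE | by apply: unitE].
all: [> apply: (mulE (@Ordinal 8 1 isT)) | apply: (mulE (@Ordinal 8 2 isT))
      | apply: (mulE (@Ordinal 8 3 isT)) ].
all: by case=> m lt_m; rewrite unlock; do 8 (destruct m as [|m]; [by []|]).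
Qed.

Lemma dotzE n y z : size y = n -> size z = n ->
  dotz y z = \sum_(p < n) y`_p * z`_p.
Proof.
elim: n y z => [|n IHn] [|v y] [|w z] //=; first by rewrite big_ord0.
by move=> [sy] [sz]; rewrite big_ord_recl -(IHn y z).
Qed.

Lemma half_vec_inj y z : size y = 8%N -> size z = 8%N ->
  half_vec y = half_vec z -> y = z.
Proof.
move=> sy sz /rowP yz; apply: (@eq_from_nth _ 0) => [|p]; first by rewrite sz.
rewrite sy => p8; have := yz (Ordinal p8); rewrite !mxE /=.
by move/(divIf (_ : 2 != 0 :> R)) => /(_ _)/intr_inj-> //; rewrite pnatr_eq0.
Qed.

Lemma half_vec_inner y z : size y = 8%N -> size z = 8%N ->
  oct_inner (half_vec y) (half_vec z) = (dotz y z)%:~R / 2.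
Proof.
move=> sy sz; rewrite oct_innerE (dotzE sy sz) mulrz_sumr mulr_sumr mulr_suml.
by apply: eq_bigr => p _; rewrite !mxE intrM; field.
Qed.

Lemma half_vec_norm y : size y = 8%N ->
  oct_norm (half_vec y) = (dotz y y)%:~R / 4.
Proof.
move=> sy; apply: (mulfI (_ : 2 != 0 :> R)); first by rewrite pnatr_eq0.
by rewrite -oct_inner_norm half_vec_inner //; field.
Qed.

Lemma E8_latticeD (x y : octonion R) :
  E8_lattice R x -> E8_lattice R y -> E8_lattice R (x + y).
Proof.
move=> [c ->] [d ->]; exists (fun p => c p + d p).
by rewrite -big_split; apply: eq_bigr => p _; rewrite mulrzDr.
Qed.

Lemma E8_latticeN (x : octonion R) : E8_lattice R x -> E8_lattice R (- x).
Proof.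
move=> [c ->]; exists (fun p => - c p).
by rewrite -sumrN; apply: eq_bigr => p _; rewrite mulrNz.
Qed.

(** The dot products of the doubled generators are even. *)
Lemma E8_inner_int (x y : octonion R) : E8_lattice R x -> E8_lattice R y ->
  oct_inner x y \is a Num.int.
Proof.
have gens_size (p : 'I_8) : size (nth [::] half_gens p) = 8%N.
  by case: p => -[|[|[|[|[|[|[|[|//]]]]]]]].
have sum_inner n (F : 'I_n -> octonion R) (z : octonion R) :
    oct_inner (\sum_(p < n) F p) z = \sum_(p < n) oct_inner (F p) z.
  elim: n F => [|n IHn] F; first by rewrite !big_ord0 oct_inner0l.
  by rewrite !big_ord_recl oct_innerDl IHn.
move=> [c ->] [d ->]; rewrite sum_inner rpred_sum // => p _.
rewrite oct_innerC sum_inner rpred_sum // => q _.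
rewrite /= -!scaler_int oct_innerZl oct_innerZr.
rewrite (rpredM (intr_int _ _)) // (rpredM (intr_int _ _)) //.
rewrite !E8_gensE half_vec_inner //.
have : (2 %| dotz (nth [::] half_gens q) (nth [::] half_gens p))%Z.
  by case: q => -[|[|[|[|[|[|[|[|//]]]]]]]] lt_q;
     case: p => -[|[|[|[|[|[|[|[|//]]]]]]]] lt_p.
move=> /dvdzP[k ->]; rewrite intrM mulfK ?intr_int //.
by rewrite pnatr_eq0.
Qed.

(** In doubled coordinates, the coefficients on the last four generators are y_4,
..., y_7; the parity checks say that the coefficients on 1, i, j, k, which are then
determined, are integers. *)
Lemma E8_latticeP (x : octonion R) : E8_lattice R x <->
  exists y, [/\ size y = 8%N, hamming y & x = half_vec y].
Proof.
have comb (c : 'I_8 -> int) : \sum_(p < 8) (E8_gens R)`_p *~ c p =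
    half_vec [:: 2 * c (inord 0) - c (inord 5) - c (inord 6) - c (inord 7);
      2 * c (inord 1) + c (inord 4) + c (inord 6) - c (inord 7);
      2 * c (inord 2) + c (inord 4) - c (inord 5) + c (inord 7);
      2 * c (inord 3) + c (inord 4) + c (inord 5) - c (inord 6);
      c (inord 4); c (inord 5); c (inord 6); c (inord 7)].
  rewrite (eq_bigr (fun p : 'I_8 =>
    (c (inord p))%:~R *: half_vec (nth [::] half_gens p))); last first.
    by move=> p _; rewrite E8_gensE inord_val scaler_int.
  apply/rowP => -[m lt_m]; rewrite summxE !big_ord_recl big_ord0 !mxE.
  by do 8 (destruct m as [|m]; [by rewrite /=; field|]).
split=> [[c ->]|[y [sy /and4P[]]]].
  rewrite comb; eexists; split; last by []; first by [].
  apply/and4P; split; apply/dvdzP.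
  - by exists (c (inord 0)); rewrite /=; ring.
  - by exists (c (inord 1) + c (inord 4) + c (inord 6)); rewrite /=; ring.
  - by exists (c (inord 2) + c (inord 4) + c (inord 7)); rewrite /=; ring.
  - by exists (c (inord 3) + c (inord 4) + c (inord 5)); rewrite /=; ring.
move=> /dvdzP[c0 e0] /dvdzP[c1 e1] /dvdzP[c2 e2] /dvdzP[c3 e3] ->.
exists (fun p : 'I_8 => [:: c0; c1 - y`_4 - y`_6; c2 - y`_4 - y`_7;
   c3 - y`_4 - y`_5; y`_4; y`_5; y`_6; y`_7]`_p).
rewrite comb; congr half_vec.
case: y sy e0 e1 e2 e3 => [|y0 [|y1 [|y2 [|y3 [|y4 [|y5 [|y6 [|y7 [|//]]]]]]]]] //.
rewrite !inordK //= => _ e0 e1 e2 e3; congr [:: _, _, _, _ & _]; lia.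
Qed.

Definition E8_seq : seq (octonion R) := [seq half_vec y | y <- rootz].

Lemma mem_rootz y : y \in rootz -> [/\ size y = 8%N, hamming y & dotz y y = 4].
Proof.
rewrite mem_filter mem_sq_vectors // => /and3P[hy /eqP sy /eqP yy].
by split.
Qed.

Lemma E8_rootsP (x : octonion R) : E8_roots R x <-> x \in E8_seq.
Proof.
split=> [[/E8_latticeP[y [sy hy ->]]]|/mapP[y /mem_rootz[sy hy yy] ->]].
  rewrite /= half_vec_norm // => yy; apply: map_f.
  rewrite mem_filter hy mem_sq_vectors // sy eqxx /=.
  rewrite -(inj_eq (@intr_inj R)) -(inj_eq (divIf (_ : 4 != 0))) ?yy ?divff //;
    by rewrite pnatr_eq0.
split=> /=; first by apply/E8_latticeP; exists y.
by rewrite half_vec_norm // yy divff // pnatr_eq0.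
Qed.

Lemma E8_seq_uniq : uniq E8_seq.
Proof.
rewrite map_inj_in_uniq ?rootz_uniq // => y z /mem_rootz[sy _ _] /mem_rootz[sz _ _].
exact: half_vec_inj.
Qed.

End Lattice.

(** * Inner products and levels of roots *)

Section E8RootTheory.
Variable R : realType.
Implicit Types a b x : octonion R.

(** The basis units are pairwise orthogonal roots, and coordinates are inner
products with them up to a factor 2; they serve as a frame throughout. *)
Lemma E8_root_unit (p : 'I_8) : E8_roots R (oct_unit R p).
Proof.
have -> : oct_unit R p = half_vec R (mkseq (fun q => if q == p :> nat then 2 else 0) 8).
  apply/rowP => q; rewrite !mxE nth_mkseq //; case: eqP => _; last by rewrite mul0r.
  by rewrite divff // pnatr_eq0.
by apply/E8_rootsP/map_f; case: p => -[|[|[|[|[|[|[|[|//]]]]]]]] lt_p; vm_compute.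
Qed.

Lemma oct_inner_unit x (p : 'I_8) : oct_inner x (oct_unit R p) = 2 * x 0 p.
Proof.
rewrite oct_innerE (bigD1 p) //= big1 ?addr0 => [|q qp].
  by rewrite mxE eqxx mulr1.
by rewrite mxE [_ == _](negPf qp) mulr0.
Qed.

Lemma oct_inner_one x : oct_inner x (oct_one R) = 2 * x 0 ord0.
Proof. exact: (oct_inner_unit x ord0). Qed.

Lemma E8_root_one : E8_roots R (oct_one R).
Proof. exact: (E8_root_unit ord0). Qed.

Lemma E8_root_norm a : E8_roots R a -> oct_inner a a = 2.
Proof. by case=> _ /= na; rewrite oct_inner_norm na mulr1. Qed.

Lemma E8_root_neq0 a : E8_roots R a -> a != 0.
Proof.
move=> ra; apply/eqP => a0; have := E8_root_norm ra.
by rewrite a0 oct_inner0l => /esym/eqP; rewrite pnatr_eq0.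
Qed.

Lemma E8_rootN a : E8_roots R a -> E8_roots R (- a).
Proof. by case=> La na; split; [exact: E8_latticeN|rewrite /= oct_normN]. Qed.

Lemma E8_rootD a b : E8_roots R a -> E8_roots R b ->
  E8_roots R (a + b) <-> oct_inner a b = -1.
Proof.
move=> [La na] [Lb nb]; split=> [[_ /=]|ab]; rewrite /= in na nb *.
  by rewrite oct_normD na nb; lra.
by split; [exact: E8_latticeD|rewrite /= oct_normD na nb ab; ring].
Qed.

Lemma E8_rootB a b : E8_roots R a -> E8_roots R b ->
  E8_roots R (a - b) <-> oct_inner a b = 1.
Proof.
move=> ra rb; apply: (iff_trans (E8_rootD ra (E8_rootN rb))).
by rewrite oct_innerNr; split=> e; lra.
Qed.

Lemma E8_inner_eq2 a b : E8_roots R a -> E8_roots R b -> oct_inner a b = 2 -> a = b.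
Proof.
move=> [_ /= na] [_ /= nb] ab; apply: subr0_eq; apply: oct_norm_eq0.
by rewrite oct_normB na nb ab; ring.
Qed.

(** The integer <a, b> lies between -2 and 2 because n(a + b) and n(a - b) are 2 +
<a, b> and 2 - <a, b>; at the ends one of them is 0. *)
Lemma E8_inner_values a b : E8_roots R a -> E8_roots R b ->
  [\/ oct_inner a b = 0, oct_inner a b = 1 \/ oct_inner a b = -1
    | b = a \/ b = - a].
Proof.
move=> ra rb; case: (ra) (rb) => La /= na [Lb /= nb].
have /intrP[k ek] := E8_inner_int La Lb.
have kle : k <= 2.
  have := oct_norm_ge0 (a - b); rewrite oct_normB na nb ek.
  by rewrite -(ler_int R) => e; lra.
have kge : -2 <= k.
  have := oct_norm_ge0 (a + b); rewrite oct_normD na nb ek.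
  by rewrite -(ler_int R) => e; rewrite mulrNz; lra.
have : k = 0 \/ k = 1 \/ k = -1 \/ k = 2 \/ k = -2 by lia.
case=> [k0|[k1|[k1|[k2|k2]]]]; rewrite ek ?k0 ?k1 ?k2.
- by constructor 1.
- by constructor 2; left.
- by constructor 2; right; rewrite mulrNz.
- constructor 3; left; apply/esym/E8_inner_eq2 => //.
  by rewrite ek k2.
constructor 3; right; rewrite -[b]opprK; congr (- _); apply/esym.
apply: E8_inner_eq2 => //; first exact: E8_rootN.
by rewrite oct_innerNr ek k2 -mulrNz.
Qed.

Lemma E8_reflection a b : E8_roots R a -> E8_roots R b ->
  E8_roots R (b - oct_inner b a *: a).
Proof.
move=> ra rb.
have [-> | [ba|ba] | [->|->]] := E8_inner_values rb ra.
- by rewrite scale0r subr0.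
- by rewrite ba scale1r; apply/E8_rootB.
- by rewrite ba scaleN1r opprK; apply/E8_rootD.
- rewrite E8_root_norm // (_ : b - _ = - b); first exact: E8_rootN.
  by rewrite scaler_nat mulr2n opprD addrA subrr sub0r.
- rewrite oct_innerNr E8_root_norm // (_ : b - _ = - b); first exact: E8_rootN.
  by rewrite scalerN scaleNr opprK scaler_nat mulr2n opprD addrA subrr sub0r.
Qed.

(** The roots of degree p for the grading defined by the root 1. *)
Definition E8_level (p : int) : set (octonion R) :=
  E8_roots R `&` [set x | oct_inner x (oct_one R) = p%:~R].

Definition E8_level_seq (p : int) : seq (octonion R) :=
  [seq half_vec R y | y <- rootz & y`_0 == p].

Lemma half_vec_one y : oct_inner (half_vec R y) (oct_one R) = (y`_0)%:~R.
Proof. by rewrite oct_inner_one mxE; field. Qed.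

Lemma E8_levelP p x : E8_level p x <-> x \in E8_level_seq p.
Proof.
split=> [[/E8_rootsP/mapP[y yr ->]]|/mapP[y]].
  rewrite /= half_vec_one => /intr_inj y0.
  by apply: map_f; rewrite mem_filter y0 eqxx.
rewrite mem_filter => /andP[/eqP y0 yr] ->.
by split; [apply/E8_rootsP/map_f|rewrite /= half_vec_one y0].
Qed.

Lemma E8_level_seq_uniq p : uniq (E8_level_seq p).
Proof.
have sub y : y \in [seq y <- rootz | y`_0 == p] -> size y = 8%N.
  by rewrite mem_filter => /andP[_ /mem_rootz[]].
rewrite map_inj_in_uniq ?filter_uniq ?rootz_uniq // => y z /sub sy /sub sz.
exact: half_vec_inj.
Qed.

Lemma E8_level_count p : size (E8_level_seq p) = count (fun y => y`_0 == p) rootz.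
Proof. by rewrite size_map size_filter. Qed.

Lemma E8_level_values x : E8_roots R x ->
  exists2 p : int, p \in [:: 2; 1; 0; -1; -2] & E8_level p x.
Proof.
move=> rx; have r1 := E8_root_one.
have [e|[e|e]|[e|e]] := E8_inner_values rx r1; rewrite /E8_level.
- by exists 0.
- by exists 1.
- by exists (-1); rewrite //; split=> //=; rewrite e mulrNz.
- by exists 2; rewrite //; split=> //=; rewrite e E8_root_norm.
- exists (-2) => //; split=> //=.
  by rewrite e oct_innerNr E8_root_norm // mulrNz.
Qed.

Lemma E8_level_pm2 : E8_level 2 = [set oct_one R] /\ E8_level (-2) = [set - oct_one R].
Proof.
split; apply/seteqP; split=> x /=.
- by move=> [rx e]; apply: E8_inner_eq2 => //; exact: E8_root_one.
- move=> ->; split; first exact: E8_root_one.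
  by rewrite /= E8_root_norm //; exact: E8_root_one.
- move=> [rx /= e]; rewrite -[x]opprK; congr (- _); apply: E8_inner_eq2.
  + exact: E8_rootN.
  + exact: E8_root_one.
  + by rewrite oct_innerNl e -mulrNz.
- move=> ->; split; first exact/E8_rootN/E8_root_one.
  by rewrite /= oct_innerNl E8_root_norm ?mulrNz //; exact: E8_root_one.
Qed.

(** With r = Re(x), the square of conj(x) is 2 r conj(x) - 1. Its real part equals r
when r = 1 or r = -1/2, and its imaginary part is -2 r times that of x; for r = 1
the latter forces x = 1. *)
Lemma E8_idempotent x : oct_norm x = 1 ->
  oct_para x x = x <-> x = oct_one R \/ oct_inner x (oct_one R) = -1.
Proof.
move=> nx; rewrite /oct_para oct_sqr.
have -> : oct_norm (oct_conj x) = 1.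
  rewrite -nx !oct_normE; apply: eq_bigr => p _; rewrite mxE.
  by case: ifP; rewrite ?sqrrN.
have -> : oct_re (oct_conj x) = x 0 ord0 by rewrite /oct_re mxE.
rewrite oct_inner_one scale1r.
have xone : (forall p : 'I_8, p != ord0 -> x 0 p = 0) -> x = x 0 ord0 *: oct_one R.
  move=> x0; apply/rowP => p; rewrite !mxE.
  case: (eqVneq p ord0) => [->|p0]; first by rewrite /= mulr1.
  by rewrite x0 // [_ == _](negPf p0) mulr0.
split=> [/rowP e|[->|e]].
- have e0 := e ord0; rewrite !mxE /= in e0.
  have [x0|x0] := eqVneq (x 0 ord0) 1.
    left; rewrite xone ?x0 ?scale1r // => p p0.
    have := e p; rewrite !mxE /= [p == 0 :> nat](negPf p0) x0 /= => ep.
    by lra.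
  right; have : (x 0 ord0 - 1) * (2 * x 0 ord0 + 1) = 0.
    by rewrite -[RHS](subrr (x 0 ord0)) -[X in _ = X - _]e0; ring.
  by move/eqP; rewrite mulf_eq0 subr_eq0 (negPf x0) /= => /eqP; lra.
- by apply/rowP => p; rewrite !mxE /=; case: (p == 0 :> nat) => /=; ring.
have {}e : x 0 ord0 = - 2^-1 by lra.
apply/rowP => p; rewrite !mxE.
case: ifP => [/eqP p0|_]; rewrite e /=; last by field.
by rewrite (_ : p = ord0) ?e; [field|exact: val_inj].
Qed.

End E8RootTheory.

Arguments E8_level R p _ : clear implicits.

(** * The E7 roots and the Gosset graph *)

(** Pairing a linear relation between the d_p with each d_q gives a row vector in
the kernel of A. *)
Lemma gram_free (K : numFieldType) (V : vectType K) n (A : 'M[int]_n)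
    (d : n.-tuple V) (pair : V -> V -> K) :
    (forall q, scalar (pair^~ (tnth d q))) ->
    (forall p q, pair (tnth d p) (tnth d q) = (A p q)%:~R) ->
  \det A != 0 -> free d.
Proof.
move=> pair_lin pairE detA; apply/freeP => k k0 i.
have pair_sum q (I : seq 'I_n) : pair (\sum_(p <- I) k p *: tnth d p) (tnth d q) =
    \sum_(p <- I) k p * (A p q)%:~R.
  have pair0 : pair 0 (tnth d q) = 0.
    by apply: (addrI (pair 0 (tnth d q))); have := pair_lin q 1 0 0;
       rewrite scale1r mul1r !addr0.
  elim: I => [|p I IHI]; first by rewrite !big_nil.
  by rewrite !big_cons pair_lin IHI pairE.
pose B := map_mx (intr : int -> K) A.
have uB : B \in unitmx.
  by rewrite unitmxE det_map_mx unitfE intr_eq0.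
have kB : (\row_p k p) *m B = 0.
  apply/rowP => q; rewrite !mxE; transitivity (pair 0 (tnth d q)).
    rewrite -k0 (eq_bigr (fun p => k p *: tnth d p)) => [|p _]; last first.
      by rewrite (tnth_nth 0).
    by rewrite pair_sum; apply: eq_bigr => p _; rewrite !mxE.
  by have := pair_sum q [::]; rewrite !big_nil.
have /rowP/(_ i) : (\row_p k p) = 0.
  by rewrite -[LHS](mulmxK uB) kB mul0mx.
by rewrite !mxE.
Qed.

Section E7.
Variable R : realType.

(** The simple roots of the system orthogonal to 1, in the order of E7_cartan. *)
Definition E7_simple_half : seq (seq int) :=
  [:: [:: 0; 1; -1; -1; -1; 0; 0; 0]; [:: 0; 0; 0; 0; 0; 2; 0; 0];
      [:: 0; 0; 0; 0; 2; 0; 0; 0]; [:: 0; 0; 0; 1; -1; -1; -1; 0];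
      [:: 0; 0; 0; 0; 0; 0; 2; 0]; [:: 0; 0; 1; -1; 0; 0; -1; -1];
      [:: 0; 0; 0; 0; 0; 0; 0; 2]].

(** The dual basis of the simple roots: the fundamental weights. *)
Definition E7_weight_half : seq (seq int) :=
  [:: [:: 0; 2; 0; 0; 0; 0; 0; 0]; [:: 0; 2; 1; 1; 0; 1; 0; 0];
      [:: 0; 3; 1; 1; 1; 0; 0; 0]; [:: 0; 4; 2; 2; 0; 0; 0; 0];
      [:: 0; 3; 2; 1; 0; 0; 1; 0]; [:: 0; 2; 2; 0; 0; 0; 0; 0];
      [:: 0; 1; 1; 0; 0; 0; 0; 1]].

(** The absolute value of the coefficient of y on the p-th simple root; the inner
product is half of the dot product of the doubled vectors. *)
Definition E7_coord (y : seq int) (p : nat) : nat :=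
  `|dotz y (nth [::] E7_weight_half p)| %/ 2.

Lemma E7_coordP : all (fun y =>
    has (fun s : int => all (fun m : nat => y`_m ==
      s * foldr (fun p t => (nth [::] E7_simple_half p)`_m * (E7_coord y p)%:Z + t) 0
            (iota 0 7)) (iota 0 8))
      [:: 1; -1])
  [seq y <- rootz | y`_0 == 0].
Proof. by vm_compute. Qed.

(** The dot products of the doubled fundamental weights are the entries of twice the
inverse of the Cartan matrix. *)
Lemma E7_det : \det E7_cartan != 0.
Proof.
pose B : 'M[int]_7 := \matrix_(p, q)
  (dotz (nth [::] E7_weight_half p) (nth [::] E7_weight_half q)).
have AB : E7_cartan *m B = 2%:M.
  apply/matrixP => p q; rewrite /E7_cartan /B !mxE !big_ord_recl big_ord0 !mxE.
  by case: p => -[|[|[|[|[|[|[|//]]]]]]] lt_p;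
     case: q => -[|[|[|[|[|[|[|//]]]]]]] lt_q; apply/eqP; vm_compute.
have : \det E7_cartan * \det B = 2 ^+ 7 by rewrite -det_mulmx AB det_scalar.
by move=> e; apply/eqP => d0; move: e; rewrite d0 mul0r.
Qed.

Lemma E7_level0_base : exists d : 7.-tuple (octonion R),
  root_base (E8_level R 0) d /\
  forall p q : 'I_7, oct_pairing (tnth d p) (tnth d q) = (E7_cartan p q)%:~R.
Proof.
pose d := [tuple half_vec R (nth [::] E7_simple_half p) | p < 7].
have dz (p : 'I_7) : nth [::] E7_simple_half p \in [seq y <- rootz | y`_0 == 0].
  by case: p => -[|[|[|[|[|[|[|//]]]]]]] lt_p; vm_compute.
have dE (p : 'I_7) : tnth d p = half_vec R (nth [::] E7_simple_half p).
  by rewrite tnth_mktuple.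
have dl (p : 'I_7) : E8_level R 0 (tnth d p).
  by apply/E8_levelP; rewrite dE; apply: map_f.
have dpair p q : oct_pairing (tnth d p) (tnth d q) = (E7_cartan p q)%:~R.
  rewrite /oct_pairing (E8_root_norm (dl q).1) mulrC mulKf ?pnatr_eq0 //.
  have size8 (r : 'I_7) : size (nth [::] E7_simple_half r) = 8%N.
    by case: r => -[|[|[|[|[|[|[|//]]]]]]] lt_r.
  rewrite !dE half_vec_inner ?size8 //.
  have -> : dotz (nth [::] E7_simple_half p) (nth [::] E7_simple_half q) =
      2 * E7_cartan p q.
    rewrite /E7_cartan mxE.
    by case: p => -[|[|[|[|[|[|[|//]]]]]]] lt_p;
       case: q => -[|[|[|[|[|[|[|//]]]]]]] lt_q; apply/eqP; vm_compute.
  by rewrite intrM mulrC mulKf // pnatr_eq0.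
exists d; split=> //; split=> //.
  apply: (gram_free (pair := @oct_pairing R)) dpair E7_det => q c x y.
  by rewrite /oct_pairing oct_innerDl oct_innerZl; ring.
move=> b /E8_levelP/mapP[y yl ->].
have /hasP[s s1 /allP ys] := allP E7_coordP y yl.
exists (fun p => E7_coord y p).
have -> : half_vec R y = s%:~R *: \sum_(p < 7) tnth d p *+ E7_coord y p.
  apply/rowP => m; have /ys/eqP ym : (m : nat) \in iota 0 8 by rewrite mem_iota /=.
  rewrite !mxE ym summxE intrM -mulrA; congr (_ * _).
  rewrite -[iota 0 7]/(index_iota 0 7).
  have -> : foldr (fun (p : nat) (t : int) =>
      (nth [::] E7_simple_half p)`_m * (E7_coord y p)%:Z + t) 0 (index_iota 0 7)
      = \sum_(p < 7) (nth [::] E7_simple_half p)`_m * (E7_coord y p)%:Z.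
    by rewrite -(big_mkord xpredT (fun p =>
      (nth [::] E7_simple_half p)`_m * (E7_coord y p)%:Z)) unlock.
  rewrite mulrz_sumr mulr_suml; apply: eq_bigr => p _.
  by rewrite dE mulmxnE !mxE intrM -mulr_natr; field.
move: s1; rewrite !inE => /orP[]/eqP->; first by left; rewrite scale1r.
by right; rewrite mulrNz scaleN1r.
Qed.

Lemma E8_level0_reflection p a b : E8_level R 0 a -> E8_level R p b ->
  E8_level R p (b - oct_inner b a *: a).
Proof.
move=> [ra /= a0] [rb /= bp]; split; first exact: E8_reflection.
by rewrite /= oct_innerBl oct_innerZl a0 mulr0 subr0.
Qed.

Lemma oct_pairing_root x a : E8_roots R a -> oct_pairing x a = oct_inner x a.
Proof.
by move=> ra; rewrite /oct_pairing E8_root_norm // mulrC mulKf // pnatr_eq0.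
Qed.

Lemma E8_finite : finite_set (E8_roots R).
Proof.
apply/finite_seqP; exists (E8_seq R).
by apply/seteqP; split=> x /E8_rootsP.
Qed.

Lemma E7_level0 : root_system_of_type E7_cartan (E8_level R 0) (@oct_pairing R).
Proof.
split; last exact: E7_level0_base.
split.
- split; first exact: (sub_finite_set (@subIsetl _ _ _)) E8_finite.
  by move=> [/E8_root_neq0]; rewrite eqxx.
- move=> a [ra _]; split; last by rewrite oct_pairing_root // E8_root_norm.
  move=> c x y; rewrite /oct_pairing oct_innerDl oct_innerZl; ring.
- move=> a b la lb; rewrite oct_pairing_root; last by case: la.
  exact: E8_level0_reflection.
- move=> a b [[La na] a0] [[Lb nb] b0]; rewrite oct_pairing_root //.
  exact/intrP/E8_inner_int.
- move=> a c [ra _] [rca _]; apply/pred2P; rewrite -eqf_sqr expr1n.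
  have := E8_root_norm rca; rewrite oct_innerZl oct_innerZr E8_root_norm //.
  by move=> e; apply/eqP; lra.
Qed.

(** A root of level s; its support is a word of the Hamming code. *)
Definition gosset_base (s : int) : seq int := [:: s; 0; 1; 1; 0; 1; 0; 0].

(** Two roots of the same level 1 or -1 are adjacent in the Gosset graph when their
inner product is 1, that is, when their doubled dot product is 2. The sets n1 and n2
consist of the neighbours of the base point and of the neighbours of n1; that every
vertex has a neighbour in n2 bounds the distance to the base point by 3. *)
Lemma gosset_check : all (fun s =>
  let l := [seq y <- rootz | y`_0 == s] in
  let adj y z := dotz y z == 2 in
  let n1 := [seq y <- l | adj y (gosset_base s)] in
  let n2 := [seq y <- l | has (adj y) n1] in
  (gosset_base s \in rootz) && all (fun y => has (adj y) n2) l) [:: 1; -1].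
Proof. by vm_compute. Qed.

(** An edge of the Gosset graph is a translation by a root orthogonal to 1. *)
Lemma gosset_step s x y : E8_level R s x -> E8_level R s y -> oct_inner x y = 1 ->
  E8_level R 0 (y - x) /\ oct_inner x (y - x) = -1.
Proof.
move=> [rx /= xs] [ry /= ys] xy; split; last first.
  by rewrite oct_innerBr xy E8_root_norm //; ring.
split; first by apply/E8_rootB => //; rewrite oct_innerC.
by rewrite /= oct_innerBl xs ys subrr.
Qed.

(** The same principle serves for submodules, with P x saying that the root space of
x is contained in the submodule, and for orbits of the Weyl group, since x + a is
then the reflection of x in a. *)
Lemma gosset_connected s (P : octonion R -> Prop) : s \in [:: 1; -1] ->
  (forall x a, E8_level R s x -> E8_level R 0 a -> oct_inner x a = -1 ->
     P x -> P (x + a)) ->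
  forall x y, E8_level R s x -> E8_level R s y -> P x -> P y.
Proof.
move=> s1 Pstep.
have Padj x y : E8_level R s x -> E8_level R s y -> oct_inner x y = 1 -> P x -> P y.
  move=> lx ly xy Px; have [l0 e] := gosset_step lx ly xy.
  by rewrite -(subrKC x y); apply: Pstep.
have /andP[] := allP gosset_check s s1.
set l := [seq y <- rootz | y`_0 == s]; set b := gosset_base s => rb /allP conn.
have lz y : y \in l -> E8_level R s (half_vec R y).
  by move=> yl; apply/E8_levelP/map_f.
have sl y : y \in l -> size y = 8%N.
  by rewrite mem_filter => /andP[_ /mem_rootz[]].
have adjz y z : y \in l -> z \in l -> dotz y z == 2 ->
    P (half_vec R y) <-> P (half_vec R z).
  move=> yl zl /eqP yz.
  have e : oct_inner (half_vec R y) (half_vec R z) = 1.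
    by rewrite half_vec_inner ?sl // yz divff // pnatr_eq0.
  by split; apply: Padj; rewrite // 1?oct_innerC //; apply: lz.
have bl : b \in l by rewrite mem_filter rb eqxx.
have Pb y : y \in l -> P (half_vec R y) <-> P (half_vec R b).
  move=> yl; have /hasP[z] := conn y yl.
  rewrite mem_filter => /andP[/hasP[w]].
  rewrite mem_filter => /andP[wb wl] zw zl yz.
  by rewrite (adjz y z) // (adjz z w) // (adjz w b).
move=> x y /E8_levelP/mapP[u ul ->] /E8_levelP/mapP[v vl ->].
by rewrite !Pb.
Qed.

(** Any two of the imaginary units are both non-orthogonal to some root that is
orthogonal to 1. *)
Lemma E7_units_check : all (fun p => all (fun q => has (fun y =>
    (y`_0 == 0) && (y`_p != 0) && (y`_q != 0)) rootz) (iota 1 7)) (iota 1 7).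
Proof. by vm_compute. Qed.

Lemma E8_level_unit (p : 'I_8) : p != ord0 -> E8_level R 0 (oct_unit R p).
Proof.
move=> p0; split; first exact: E8_root_unit.
by rewrite /= oct_inner_one mxE eq_sym [_ == _](negPf p0) mulr0.
Qed.

(** Every root orthogonal to 1 is non-orthogonal to some imaginary unit; the units
are linked by E7_units_check. *)
Lemma E7_connected (P : octonion R -> Prop) :
  (forall a b, E8_level R 0 a -> E8_level R 0 b -> oct_inner a b != 0 ->
     P a -> P b) ->
  forall a b, E8_level R 0 a -> E8_level R 0 b -> P a -> P b.
Proof.
move=> Pstep a b la lb.
have coord x : E8_level R 0 x -> exists2 p : 'I_8, p != ord0 & x 0 p != 0.
  move=> [rx /=]; rewrite oct_inner_one => /eqP.
  rewrite mulf_eq0 pnatr_eq0 /= => /eqP x0.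
  have [/existsP[p xp]|] := boolP [exists p, x 0 p != 0].
    by exists p => //; apply: contraNneq xp => ->; rewrite x0.
  rewrite negb_exists => /forallP x00; case/negP: (E8_root_neq0 rx).
  by apply/eqP/rowP => p; rewrite mxE; apply/eqP; have := x00 p; rewrite negbK.
have [p p0 ap] := coord a la; have [q q0 bq] := coord b lb.
have nz2 : 2 != 0 :> R by rewrite pnatr_eq0.
have inI (r : 'I_8) : r != ord0 -> (r : nat) \in iota 1 7.
  by case: r => -[|[|[|[|[|[|[|[|//]]]]]]]] lt_r.
have /hasP[y yr /andP[/andP[y0 yp] yq]] := allP (allP E7_units_check p (inI p p0)) q (inI q q0).
have ly : E8_level R 0 (half_vec R y).
  by apply/E8_levelP/map_f; rewrite mem_filter y0.
have yz (r : 'I_8) : y`_r != 0 -> half_vec R y 0 r != 0.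
  by move=> yr0; rewrite mxE mulf_neq0 ?intr_eq0 // invr_eq0.
move=> Pa.
have Pp : P (oct_unit R p).
  apply: (Pstep a) => //; first exact: E8_level_unit.
  by rewrite oct_inner_unit mulf_neq0.
have Py : P (half_vec R y).
  apply: (Pstep (oct_unit R p)) => //; first exact: E8_level_unit.
  by rewrite oct_innerC oct_inner_unit mulf_neq0 ?yz.
have Pq : P (oct_unit R q).
  apply: (Pstep (half_vec R y)) => //; first exact: E8_level_unit.
  by rewrite oct_inner_unit mulf_neq0 ?yz.
apply: (Pstep (oct_unit R q)) => //; first exact: E8_level_unit.
by rewrite oct_innerC oct_inner_unit mulf_neq0.
Qed.

End E7.

(** * Counting the roots *)

(** Opaque, so that the 240 vectors are never expanded by conversion in what
follows. *)
Lemma E8_enumeration (R : realType) :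
  {s : seq (octonion R) | uniq s & forall x, E8_roots R x <-> x \in s}.
Proof. by exists (E8_seq R); [exact: E8_seq_uniq|exact: E8_rootsP]. Qed.

Definition E8_list (R : realType) : seq (octonion R) := s2val (E8_enumeration R).

Lemma E8_list_uniq (R : realType) : uniq (E8_list R).
Proof. exact: (s2valP (E8_enumeration R)). Qed.

Lemma E8_listP (R : realType) (x : octonion R) : E8_roots R x <-> x \in E8_list R.
Proof. exact: (s2valP' (E8_enumeration R)). Qed.

Lemma card_uniq_seq (T : eqType) (s : seq T) (A : set T) : uniq s ->
  (forall x, A x <-> x \in s) -> A #= `I_(size s).
Proof.
move=> us As; apply/card_set_bijP; exists (index^~ s); split.
- by move=> x /= /As xs; rewrite index_mem.
- by move=> x y /set_mem/As xs /set_mem/As ys /(congr1 (nth x s)); rewrite !nth_index.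
- move=> n /= ns; have x0 : T by case: s ns {us As} => [|x s].
  exists (nth x0 s n); first by apply/As/mem_nth.
  by rewrite index_uniq.
Qed.

Lemma rootz_counts : [/\ count (fun y => y`_0 == 2) rootz = 1%N,
  count (fun y => y`_0 == 1) rootz = 56%N, count (fun y => y`_0 == 0) rootz = 126%N,
  count (fun y => y`_0 == -1) rootz = 56%N & count (fun y => y`_0 == -2) rootz = 1%N].
Proof. by vm_compute. Qed.

Section Counts.
Variable R : realType.

Definition E8_level_list (p : int) : seq (octonion R) :=
  [seq b <- E8_list R | oct_inner b (oct_one R) == p%:~R].

Lemma E8_level_list_uniq p : uniq (E8_level_list p).
Proof. by rewrite filter_uniq ?E8_list_uniq. Qed.

Lemma E8_level_listP p b : E8_level R p b <-> b \in E8_level_list p.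
Proof.
rewrite mem_filter; split=> [[/E8_listP -> /= ->]|]; first by rewrite eqxx.
by case/andP=> /eqP bp /E8_listP.
Qed.

Lemma E8_level_size : [/\ size (E8_level_list 2) = 1%N, size (E8_level_list 1) = 56%N,
  size (E8_level_list 0) = 126%N, size (E8_level_list (-1)) = 56%N
  & size (E8_level_list (-2)) = 1%N].
Proof.
have sizeE p : size (E8_level_list p) = count (fun y => y`_0 == p) rootz.
  rewrite -(E8_level_count R); apply: perm_size; apply: uniq_perm.
  - exact: E8_level_list_uniq.
  - exact: E8_level_seq_uniq.
  - by move=> b; apply/idP/idP => [/E8_level_listP/E8_levelP|/E8_levelP/E8_level_listP].
case: rootz_counts => n2 n1 n0 nm1 nm2; split; rewrite sizeE;
  [exact: n2|exact: n1|exact: n0|exact: nm1|exact: nm2].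
Qed.

Lemma E8_list_size : size (E8_list R) = 240%N.
Proof.
have <- : size rootz = 240%N by vm_compute.
rewrite -(size_map (half_vec R)); apply: perm_size; apply: uniq_perm.
- exact: E8_list_uniq.
- exact: E8_seq_uniq.
- by move=> b; apply/idP/idP => [/E8_listP/E8_rootsP|/E8_rootsP/E8_listP].
Qed.

Lemma E8_level_card p : E8_level R p #= `I_(size (E8_level_list p)).
Proof. exact: card_uniq_seq (E8_level_list_uniq p) (E8_level_listP p). Qed.

End Counts.

(** * Diagonalizable elements of a Lie algebra *)

Section LieBasics.
Variables (K : fieldType) (L : lieAlgType K).
Implicit Types x y z : L.

Lemma lieC x y : lie x y = - lie y x.
Proof.
apply/eqP; rewrite -addr_eq0; apply/eqP.
have := liexx (x + y); rewrite lieDl !linearD /= !liexx.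
by rewrite add0r addr0.
Qed.

Lemma lieDr x y z : lie x (y + z) = lie x y + lie x z.
Proof. exact: linearD. Qed.

Lemma lie0r x : lie x 0 = 0.
Proof. exact: linear0. Qed.

Lemma lieNr x y : lie x (- y) = - lie x y.
Proof. exact: linearN. Qed.

Lemma lieNl x y : lie (- x) y = - lie x y.
Proof. by rewrite -scaleN1r lieZl scaleN1r. Qed.

Lemma lieZr (c : K) x y : lie x (c *: y) = c *: lie x y.
Proof. exact: linearZ. Qed.

Lemma lie_leibniz x y z : lie x (lie y z) = lie (lie x y) z + lie y (lie x z).
Proof.
have := lie_jacobi x y z; rewrite (lieC z (lie x y)) (lieC z x) lieNr.
by move/eqP; rewrite -addrA addr_eq0 => /eqP ->; rewrite opprD !opprK addrC.
Qed.

Lemma lie_suml_seq (I : Type) (s : seq I) (F : I -> L) z :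
  lie (\sum_(i <- s) F i) z = \sum_(i <- s) lie (F i) z.
Proof.
by apply: (big_morph (fun y => lie y z)) => [x y|]; rewrite ?lieDl ?lie0l.
Qed.

Section StableComponents.
Variables (I : eqType) (w : I -> L -> K) (T N : L -> Prop).
Hypothesis N_lin : forall c u v, N u -> N v -> N (c *: u + v).
Hypothesis N_stable : forall h v, T h -> N v -> N (lie h v).

(** By induction on s. If h separates a from b, applying ad h - w a h to the sum
kills the component at a, multiplies the component at b by a nonzero scalar and
leaves a sum over s to which the induction hypothesis applies. Being a predicate, N
may also be a joint eigenspace given by equations. *)
Lemma stable_components (s : seq I) (x : I -> L) : uniq s ->
  {in s &, forall a b, a != b -> exists2 h, T h & w a h != w b h} ->
  {in s, forall a h, T h -> lie h (x a) = w a h *: x a} ->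
  N (\sum_(a <- s) x a) -> {in s, forall a, N (x a)}.
Proof.
elim: s x => [//|a s IHs] x /andP[a_s us] sep wx Nx.
have N0 : N 0 by have := N_lin (-1) Nx Nx; rewrite scaleN1r addNr.
have Ns b : b \in s -> N (x b).
  move=> bs; have [||h Th wab] := sep b a _ _ (memPn a_s b bs).
  - by rewrite inE bs orbT.
  - by rewrite inE eqxx.
  pose y c := (w c h - w a h) *: x c.
  have : N (y b).
    apply: (IHs y us) => //.
    - by move=> c d cs ds; apply: sep; rewrite inE ?cs ?ds orbT.
    - move=> c cs k Tk; rewrite /y lieZr wx ?inE ?cs ?orbT //.
      by rewrite scalerA mulrC -scalerA.
    have -> : \sum_(c <- s) y c =
        - w a h *: (\sum_(c <- a :: s) x c) + lie h (\sum_(c <- a :: s) x c).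
      rewrite [lie h _]linear_sum !big_cons /= wx ?inE ?eqxx // scalerDr scaleNr.
      rewrite addrACA addNr add0r scaler_sumr -big_split /=.
      apply: eq_big_seq => c cs.
      by rewrite wx ?inE ?cs ?orbT // -scalerDl addrC.
    by apply: N_lin => //; apply: N_stable.
  move=> /(N_lin (w b h - w a h)^-1)/(_ N0).
  by rewrite addr0 scalerA mulVf ?scale1r // subr_eq0.
move=> b; rewrite inE => /orP[/eqP->|]; last exact: Ns.
have Nsum : N (\sum_(c <- s) x c).
  rewrite big_seq; elim/big_rec: _ => // c v cs Nv.
  by rewrite -[x c]scale1r; apply: N_lin => //; apply: Ns.
move: Nx; rewrite big_cons => /(N_lin (-1) Nsum).
by rewrite scaleN1r addrC addrK.
Qed.

End StableComponents.

Lemma memv_sum_seqP (I : eqType) (s : seq I) (F : I -> {vspace L}) v : uniq s ->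
  reflect (exists2 x : I -> L, {in s, forall a, x a \in F a} &
             v = \sum_(a <- s) x a)
          (v \in \sum_(a <- s) F a)%VS.
Proof.
move=> us; apply: (iffP idP); last first.
  case=> x + ->; elim: s {us} => [|a s IHs] xF; first by rewrite !big_nil mem0v.
  rewrite !big_cons memv_add ?xF ?mem_head // IHs // => b bs.
  by rewrite xF // inE bs orbT.
elim: s v us => [|a s IHs] v /=.
  by rewrite big_nil memv0 => _ /eqP ->; exists (fun=> 0) => //; rewrite big_nil.
case/andP=> a_s us; rewrite big_cons => /memv_addP[u uF [t /(IHs _ us)[x xF ->] ->]].
exists (fun b => if b == a then u else x b) => [b|].
  by rewrite inE; case: eqP => [-> //|_ /= bs]; apply: xF.
rewrite big_cons eqxx; congr (_ + _).
by apply: eq_big_seq => b bs; rewrite (negPf (memPn a_s b bs)).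
Qed.

(** The eigencomponents of v for h belong to every h-stable subspace that contains
v; this is what allows diagonalizing one element after the other. *)
Lemma eigen_decomposition (h v : L) (N : L -> Prop) :
  ad_diagonalizable fullv h ->
  (forall c u t, N u -> N t -> N (c *: u + t)) ->
  (forall u, N u -> N (lie h u)) -> N v ->
  exists2 s : seq L, v = \sum_(u <- s) u &
    {in s, forall u, N u /\ exists a : K, lie h u = a *: u}.
Proof.
move=> [X basisX eigX] N_lin N_stable Nv.
have eig (i : 'I_(size X)) : {a : K | lie h X`_i == a *: X`_i}.
  by apply: sigW; have [a e] := eigX _ (mem_nth 0 (ltn_ord i)); exists a; apply/eqP.
pose a i := sval (eig i); pose t := in_tuple X.
pose y i := coord t i v *: X`_i.
pose s := undup [seq a i | i : 'I_(size X)].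
pose x b := \sum_(i | a i == b) y i.
have xE b : lie h (x b) = b *: x b.
  rewrite linear_sum scaler_sumr; apply: eq_bigr => i /eqP <-.
  by rewrite /= lieZr (eqP (svalP (eig i))) scalerA mulrC -scalerA.
have vE : v = \sum_(b <- s) x b.
  have vX : v \in <<t>>%VS by rewrite (span_basis basisX) memvf.
  rewrite {1}(coord_span vX) (exchange_big_dep xpredT) //=; apply: eq_bigr => i _.
  rewrite -big_filter (_ : [seq b <- s | a i == b] = [:: a i]) ?big_seq1 //.
  apply: perm_small_eq => //; apply: uniq_perm; rewrite ?filter_uniq ?undup_uniq // => b.
  rewrite mem_filter inE mem_undup eq_sym andb_idr // => /eqP ->.
  by apply: map_f; rewrite mem_enum.
exists [seq x b | b <- s]; first by rewrite big_map.
move=> u /mapP[b bs ->]; split; last by exists b.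
apply: (@stable_components _ (fun b _ => b) (fun k => k = h) N) bs => //.
- by move=> k u' ->; apply: N_stable.
- exact: undup_uniq.
- by move=> c d _ _ cd; exists h.
- by move=> c _ k ->; apply: xE.
- by rewrite -vE.
Qed.

(** A spanning sequence contains a basis. *)
Lemma eigenvectors_basis (h : L) (Y : seq L) :
  {in Y, forall y : L, exists c : K, lie h y = c *: y} ->
  ad_diagonalizable <<Y>>%VS h.
Proof.
move=> eY; suff [X [fX sX XY]] : exists X : seq L,
    [/\ free X, <<X>>%VS = <<Y>>%VS & {subset X <= Y}].
  exists X; first by rewrite /basis_of sX eqxx.
  by move=> x /XY; apply: eY.
elim: Y {eY} => [|y Y [X [fX sX XY]]].
  by exists [::]; split; rewrite // nil_free.
have [yX|yX] := boolP (y \in <<X>>%VS).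
  exists X; split=> // [|x /XY xY]; last by rewrite inE xY orbT.
  by rewrite span_cons -sX; apply/esym/addv_idPr; rewrite -memvE.
exists (y :: X); split; first by rewrite free_cons yX.
  by rewrite !span_cons sX.
by move=> x; rewrite !inE => /orP[->//|/XY ->]; rewrite orbT.
Qed.

(** Joint eigenvectors for the elements of a list are split further by each new
element, whose eigencomponents remain joint eigenvectors because the elements
commute. *)
Lemma weight_decomposition (H : {vspace L}) (v : L) :
  bracket_in H H 0%VS ->
  (forall h, h \in H -> ad_diagonalizable fullv h) ->
  exists2 s : seq L, v = \sum_(u <- s) u &
    {in s, forall u, exists mu : dual_space H, u \in weight_space fullv mu}.
Proof.
move=> abH diagH.
have simul (hs : seq L) : {subset hs <= H} -> exists2 s : seq L, v = \sum_(u <- s) u &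
    {in s, forall u, {in hs, forall h, exists a : K, lie h u = a *: u}}.
  elim: hs => [_|h hs IHhs hsH]; first by exists [:: v]; rewrite ?big_seq1.
  have [|s -> eig] := IHhs; first by move=> k ks; apply: hsH; rewrite inE ks orbT.
  have hH : h \in H by apply: hsH; rewrite inE eqxx.
  elim: s eig => [_|u s IHs eig]; first by exists [::]; rewrite ?big_nil.
  have [|s1 s1E eig1] := IHs; first by move=> t ts; apply: eig; rewrite inE ts orbT.
  have equ := eig u (mem_head _ _).
  pose N t := {in hs, forall k, forall a, lie k u = a *: u -> lie k t = a *: t}.
  have [|||s2 s2E eig2] := @eigen_decomposition h u N (diagH h hH).
  - move=> c t1 t2 N1 N2 k ks a ea.
    by rewrite lieDr lieZr (N1 k ks a ea) (N2 k ks a ea) scalerDr !scalerA mulrC.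
  - move=> t Nt k ks a ea; rewrite lie_leibniz (Nt k ks a ea) lieZr.
    have -> : lie k h = 0.
      by apply/eqP; rewrite -memv0; apply: abH => //; apply: hsH; rewrite inE ks orbT.
    by rewrite lie0l add0r.
  - by move=> k ks a ->.
  exists (s2 ++ s1); first by rewrite big_cons big_cat /= -s1E -s2E.
  move=> t; rewrite mem_cat => /orP[ts|]; last exact: eig1.
  have [Nt hev] := eig2 t ts; move=> k; rewrite inE => /orP[/eqP -> //|ks].
  by have [a ea] := equ k ks; exists a; apply: Nt.
pose X := vbasis {:subvs_of H}.
have [|s -> eig] := simul [seq vsval h | h <- X].
  by move=> _ /mapP[h _ ->]; apply: subvsP.
exists s => // u us.
have eigX (i : 'I_(\dim {:subvs_of H})) : {a : K | lie (vsval X`_i) u == a *: u}.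
  apply: sigW; have [|a e] := eig u us (vsval X`_i).
    by apply: map_f; apply: mem_nth; rewrite size_tuple.
  by exists a; apply/eqP.
pose mu : dual_space H := \sum_i (sval (eigX i) : K) *: linfun (coord X i : _ -> K^o).
have muX (i : 'I_(\dim {:subvs_of H})) : mu X`_i = sval (eigX i).
  rewrite sum_lfunE (bigD1 i) //= big1 ?addr0 => [|j ji].
    rewrite scale_lfunE lfunE /= coord_free ?(basis_free (vbasisP _)) // eqxx.
    by rewrite [LHS]mulr1.
  rewrite scale_lfunE lfunE /= coord_free ?(basis_free (vbasisP _)) //.
  by rewrite eq_sym (negPf ji) scaler0.
exists mu; rewrite memv_cap memvf memvE; apply/subv_bigcapP => i _.
rewrite -memvE memv_ker add_lfunE opp_lfunE scale_lfunE id_lfunE adE.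
by rewrite muX; case: (eigX i) => a /= /eqP ->; rewrite subrr.
Qed.

End LieBasics.

(** * Root spaces of a Lie algebra with the roots of E8 *)

Section E8Algebra.
Variables (R : realType) (L : lieAlgType R[i]) (H : {vspace L}).
Variable rho : octonion R -> dual_space H.
Hypothesis e8H : e8_with_roots rho.
Local Notation C := (R[i]).
Local Notation Phi := (E8_roots R).
Implicit Types (a b x y : octonion R) (h k u v : L).

Let simpleL : simple_subalgebra (fullv : {vspace L}).
Proof. by case: e8H. Qed.

Let cartanH : cartan_subalgebra fullv H.
Proof. by case: e8H. Qed.

(** The value at h of the weight rho x, extended to all of L through the projection
onto H. *)
Definition wt x h : C := rho x (vsproj H h).

(** Locked because unfolding a weight space to kernels of matrices makes failing
unifications expensive. *)
Definition wspace x : {vspace L} := locked (weight_space fullv (rho x)).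
Local Notation W := wspace.

Lemma wspaceE x : W x = weight_space fullv (rho x).
Proof. by rewrite /wspace -lock. Qed.

Lemma rho_lin (c : R) x y : rho (c *: x + y) = c%:C%C *: rho x + rho y.
Proof. by case: e8H => _ _ []. Qed.

Lemma wtDZ (c : R) x y h : wt (c *: x + y) h = c%:C%C * wt x h + wt y h.
Proof. by rewrite /wt rho_lin add_lfunE scale_lfunE. Qed.

Lemma wtD x y h : wt (x + y) h = wt x h + wt y h.
Proof. by have := wtDZ 1 x y h; rewrite scale1r mul1r. Qed.

Lemma wt0 h : wt 0 h = 0.
Proof. by apply: (addrI (wt 0 h)); rewrite -wtD !addr0. Qed.

Lemma wtZ (c : R) x h : wt (c *: x) h = c%:C%C * wt x h.
Proof. by have := wtDZ c x 0 h; rewrite wt0 !addr0. Qed.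

Lemma wtN x h : wt (- x) h = - wt x h.
Proof. by rewrite -scaleN1r wtZ rmorphN1 mulN1r. Qed.

Lemma wt_r0 x : wt x 0 = 0.
Proof. by rewrite /wt !linear0. Qed.

Lemma wt_rD x h k : wt x (h + k) = wt x h + wt x k.
Proof. by rewrite /wt !linearD. Qed.

Lemma wt_rZ x (c : C) h : wt x (c *: h) = c * wt x h.
Proof. by rewrite /wt !linearZ. Qed.

Lemma wt_rN x h : wt x (- h) = - wt x h.
Proof. by rewrite /wt !linearN. Qed.

Lemma mem_wspace x v : v \in W x <-> forall h, h \in H -> lie h v = wt x h *: v.
Proof.
rewrite wspaceE mem_weight_space; split=> [[_ e] h hH|e].
  by rewrite -{1}(vsprojK hH) e.
split=> [|h]; first exact: memvf.
by rewrite e ?subvsP // /wt vsvalK.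
Qed.

Lemma lieH x h v : h \in H -> v \in W x -> lie h v = wt x h *: v.
Proof. by move=> hH /mem_wspace; apply. Qed.

(** An element of weight 0 commutes with H, which is maximal abelian. *)
Lemma wspace0 : W 0 = H.
Proof.
case: cartanH => _ abH maxH _; apply/vspaceP => v; apply/idP/idP => [vW|vH].
  by apply: maxH (memvf _) _ => h hH; rewrite (lieH hH vW) wt0 scale0r.
apply/mem_wspace => h hH; rewrite wt0 scale0r; apply/eqP; rewrite -memv0.
exact: abH.
Qed.

Lemma lieW x y u v : u \in W x -> v \in W y -> lie u v \in W (x + y).
Proof.
move=> ux vy; apply/mem_wspace => h hH.
by rewrite lie_leibniz (lieH hH ux) (lieH hH vy) lieZl lieZr wtD scalerDl.
Qed.

Lemma rho_inj : injective rho.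
Proof. by case: e8H => _ _ []. Qed.

Lemma rho0 : rho 0 = 0.
Proof.
by apply: (addrI (rho 0)); have := rho_lin 1 0 0; rewrite !scale1r !addr0.
Qed.

Lemma W_root a : Phi a -> W a != 0%VS.
Proof.
case: e8H => _ _ [_ _ im] ra.
by rewrite wspaceE; have [] : root_set fullv H (rho a) by rewrite -im; exists a.
Qed.

Lemma root_exists a : Phi a -> exists2 v, v \in W a & v != 0.
Proof.
by move=> /W_root; rewrite -vpick0 => v0; exists (vpick (W a)); rewrite ?memv_pick.
Qed.

Lemma W_nonroot x v : v \in W x -> x != 0 -> ~ Phi x -> v = 0.
Proof.
case: e8H => _ _ [_ _ im] vW x0 rx; apply/eqP; apply: contra_notT rx => v0.
have : root_set fullv H (rho x).
  split; first by apply: contra_neq x0 => e; apply: rho_inj; rewrite e rho0.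
  by apply: contraNneq v0 => W0'; move: vW; rewrite wspaceE W0' memv0.
by rewrite -im => -[y ry /rho_inj <-].
Qed.

(** A nonnegative inner product rules out that a + b is a root or 0. *)
Lemma lie_root0 a b u v : Phi a -> Phi b -> 0 <= oct_inner a b ->
  u \in W a -> v \in W b -> lie u v = 0.
Proof.
move=> ra rb ab ua vb; apply: (W_nonroot (lieW ua vb)).
  rewrite addr_eq0; apply: contraTneq ab => ->.
  by rewrite oct_innerNl E8_root_norm // oppr_ge0 lern0.
by move=> /(E8_rootD ra rb) e; move: ab; rewrite e oppr_ge0 ler10.
Qed.

(** The weight 0 is included, so that H is handled as one more weight space. *)
Definition all_weights : seq (octonion R) := 0 :: E8_list R.

Lemma all_weights_uniq : uniq all_weights.
Proof.
rewrite cons_uniq E8_list_uniq andbT; apply/negP => /E8_listP/E8_root_neq0.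
by rewrite eqxx.
Qed.

Lemma full_wspaces : fullv = (\sum_(a <- all_weights) W a)%VS.
Proof.
apply/esym/vspaceP => v; rewrite memvf.
case: cartanH => _ abH _ diagH.
have [s -> ws] := weight_decomposition v abH diagH.
rewrite big_seq; apply: memv_suml => u /ws[mu umu].
have [->|u0] := eqVneq u 0; first exact: mem0v.
have sub x : x \in all_weights -> (W x <= \sum_(a <- all_weights) W a)%VS.
  by move=> xs; rewrite (big_rem x xs) addvSl.
have [mu0|mu0] := eqVneq mu 0.
  by apply: (subvP (sub 0 (mem_head _ _))); rewrite wspaceE rho0 -mu0.
have : root_set fullv H mu.
  split=> //; apply: contraNneq u0 => e; move: umu.
  by rewrite e memv0.
case: e8H => _ _ [_ _ <-] [a /E8_listP ra e].
have aw : a \in all_weights by rewrite inE ra orbT.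
by apply: (subvP (sub a aw)); rewrite wspaceE e.
Qed.

Lemma rootW_decomposition v : exists2 x, {in all_weights, forall a, x a \in W a} &
  v = \sum_(a <- all_weights) x a.
Proof.
by apply/(memv_sum_seqP _ _ all_weights_uniq); rewrite -full_wspaces memvf.
Qed.

Lemma wt_separates x y : x != y -> exists2 h, h \in H & wt x h != wt y h.
Proof.
move=> xy; apply: contrapT => sep; case/eqP: xy; apply: rho_inj.
apply/lfunP => h; apply: contrapT => e; apply: sep.
exists (vsval h); first exact: subvsP.
by rewrite /wt !vsvalK; apply/eqP.
Qed.

Lemma W_components (N : {vspace L}) (s : seq (octonion R)) (x : octonion R -> L) :
  uniq s -> (forall h v, h \in H -> v \in N -> lie h v \in N) ->
  {in s, forall a, x a \in W a} -> \sum_(a <- s) x a \in N ->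
  {in s, forall a, x a \in N}.
Proof.
move=> us N_stable xW.
apply: (@stable_components _ _ _ wt (fun h => h \in H) (fun v => v \in N)) => //.
- by move=> c u v uN vN; rewrite memvD ?memvZ.
- by move=> a b _ _ ab; apply: wt_separates.
- by move=> a as_ h hH; apply: lieH => //; apply: xW.
Qed.

Lemma W_independent (s : seq (octonion R)) (x : octonion R -> L) :
  uniq s -> {in s, forall a, x a \in W a} -> \sum_(a <- s) x a = 0 ->
  {in s, forall a, x a = 0}.
Proof.
move=> us xW x0 a as_; apply/eqP; rewrite -memv0.
apply: (W_components us _ xW) as_; last by rewrite x0 mem0v.
by move=> h v _; rewrite memv0 => /eqP->; rewrite lie0r mem0v.
Qed.

(** Such an h commutes with every root vector, so it spans an ideal. *)
Lemma H_central h : h \in H -> (forall a, Phi a -> wt a h = 0) -> h = 0.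
Proof.
move=> hH h0.
have cent v : lie h v = 0.
  have [x xW ->] := rootW_decomposition v.
  rewrite [LHS]linear_sum big1_seq // => a /andP[_ as_] /=.
  rewrite (lieH hH (xW a as_)); move: as_; rewrite inE => /orP[/eqP->|/E8_listP ra].
    by rewrite wt0 scale0r.
  by rewrite h0 // scale0r.
case: simpleL => _ nab simp.
have [|||e] := simp <[h]>%VS; rewrite ?subvf //.
- move=> u v _ /vlineP[c ->].
  by rewrite lieZr lieC cent oppr0 scaler0 mem0v.
- by move=> e; apply/eqP; rewrite -memv0 -e memv_line.
case: nab => u v uf; rewrite -e => /vlineP[c ->].
by rewrite lieZr lieC cent oppr0 scaler0 mem0v.
Qed.

(** * Root strings and copies of sl2 *)

Lemma lie_opposite_H a u v : u \in W a -> v \in W (- a) -> lie u v \in H.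
Proof. by move=> ua va; have := lieW ua va; rewrite subrr wspace0. Qed.

Lemma wt_orthogonal a b u v : Phi a -> Phi b -> oct_inner b a = 0 ->
  u \in W a -> v \in W (- a) -> wt b (lie u v) = 0.
Proof.
move=> ra rb ba ua va; have [z zb z0] := root_exists rb.
have rNa := E8_rootN ra.
have uz : lie u z = 0.
  by apply: (lie_root0 ra rb _ ua zb); rewrite oct_innerC ba.
have vz : lie v z = 0.
  by apply: (lie_root0 rNa rb _ va zb);
    rewrite oct_innerNl oct_innerC ba ?oppr0 ?opprK ?ler01.
have := lie_leibniz u v z; rewrite uz vz !lie0r addr0.
rewrite (lieH (lie_opposite_H ua va) zb) => /esym/eqP.
by rewrite scaler_eq0 (negPf z0) orbF => /eqP.
Qed.

(** Put t = [u, v]. As b - a and b + 2 a are not roots, ad v ad u is - b(t) on W b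
and ad u ad v is (b + a)(t) on W (b + a). Comparing the two ways to compute ad u ad
v ad u and ad v ad u ad v shows that (b + a)(t) + b(t) = 0, unless ad u and ad v
vanish on these spaces, and then b(t) = (b + a)(t) = 0. *)
Lemma wt_string a b u v : Phi a -> Phi b -> oct_inner b a = -1 ->
  u \in W a -> v \in W (- a) ->
  wt a (lie u v) = - (2 * wt b (lie u v)).
Proof.
move=> ra rb ba ua va; have rNa := E8_rootN ra.
set t := lie u v; have tH : t \in H := lie_opposite_H ua va.
have rab : Phi (b + a) by apply/E8_rootD.
have up (z : L) : z \in W b -> lie v (lie u z) = - (wt b t *: z).
  move=> zb; have vz : lie v z = 0.
    by apply: (lie_root0 rNa rb _ va zb);
    rewrite oct_innerNl oct_innerC ba ?oppr0 ?opprK ?ler01.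
  have := lie_leibniz u v z; rewrite vz lie0r -/t (lieH tH zb) => /esym/eqP.
  by rewrite addrC addr_eq0 => /eqP.
have down (y : L) : y \in W (b + a) -> lie u (lie v y) = wt (b + a) t *: y.
  move=> yab; have uy : lie u y = 0.
    apply: (lie_root0 ra rab _ ua yab).
    by rewrite oct_innerDr (oct_innerC a b) ba (E8_root_norm ra) -[2]/(1 + 1) addKr ler01.
  by rewrite lie_leibniz -/t uy lie0r addr0 (lieH tH yab).
have [z zb z0] := root_exists rb; have [y yab y0] := root_exists rab.
have uzW : lie u z \in W (b + a) by rewrite addrC; exact: lieW ua zb.
have vyW : lie v y \in W b by have := lieW va yab; rewrite addrC addrK.
have e1 := down _ uzW; rewrite (up z zb) lieNr lieZr in e1.
have e2 := up _ vyW; rewrite (down y yab) lieZr in e2.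
have s0 : wt (b + a) t + wt b t = 0.
  apply/eqP; apply: contraT => s0.
  have uz0 : lie u z = 0.
    apply/eqP; move/eqP: e1; rewrite -scaleNr -subr_eq0 -scalerBl scaler_eq0.
    by rewrite -opprD oppr_eq0 addrC (negPf s0).
  have vy0 : lie v y = 0.
    apply/eqP; move/eqP: e2; rewrite -scaleNr -subr_eq0 -scalerBl scaler_eq0.
    by rewrite opprK (negPf s0).
  have := up _ zb; rewrite uz0 lie0r => /esym/eqP.
  rewrite oppr_eq0 scaler_eq0 (negPf z0) orbF => /eqP b0.
  have := down _ yab; rewrite vy0 lie0r => /esym/eqP.
  rewrite scaler_eq0 (negPf y0) orbF => /eqP ab0.
  by rewrite ab0 b0 addr0 eqxx in s0.
by apply/eqP; rewrite -addr_eq0 -s0 wtD; apply/eqP; ring.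
Qed.

Lemma realC2 : (2 : R)%:C%C = 2.
Proof. by rewrite rmorph_nat. Qed.

(** An element of [W a, W (- a)] is thus determined, as a function on the roots, by its
value under a. *)
Lemma wt_lie a b u v : Phi a -> Phi b -> u \in W a -> v \in W (- a) ->
  2 * wt b (lie u v) = (oct_inner b a)%:C%C * wt a (lie u v).
Proof.
move=> ra rb ua va.
have [ba|[ba|ba]|[->|->]] := E8_inner_values rb ra.
- by rewrite ba (wt_orthogonal ra rb ba ua va) mul0r mulr0.
- have e : oct_inner (- b) a = -1 by rewrite oct_innerNl ba.
  by rewrite (wt_string ra (E8_rootN rb) e ua va) ba mul1r wtN mulrN opprK.
- by rewrite (wt_string ra rb ba ua va) ba rmorphN1 mulN1r opprK.
- by rewrite E8_root_norm // realC2.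
by rewrite oct_innerNr E8_root_norm // rmorphN /= realC2 wtN mulrNN.
Qed.

(** By wt_lie, all roots vanish on [u, v], which is then central. *)
Lemma lie_opposite_eq0 a u v : Phi a -> u \in W a -> v \in W (- a) ->
  wt a (lie u v) = 0 -> lie u v = 0.
Proof.
move=> ra ua va t0; apply: H_central (lie_opposite_H ua va) _ => b rb.
have := wt_lie ra rb ua va; rewrite t0 mulr0 => /eqP.
by rewrite mulf_eq0 pnatr_eq0 /= => /eqP.
Qed.

(** The elements u, v and [u, v] span a copy of sl2, normalized by a([u, v]) = 2. *)
Definition sl2_pair a u v : Prop :=
  [/\ Phi a, u \in W a, v \in W (- a) & wt a (lie u v) = 2].

Lemma sl2_pairP a u v : Phi a -> u \in W a -> v \in W (- a) -> lie u v != 0 ->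
  exists c : C, sl2_pair a (c *: u) v.
Proof.
move=> ra ua va uv0; have w0 : wt a (lie u v) != 0.
  by apply: contra_neq uv0; exact: lie_opposite_eq0 ra ua va.
exists (2 / wt a (lie u v)); split; [exact: ra|exact: memvZ ua|exact: va|].
by rewrite lieZl wt_rZ divfK.
Qed.

Lemma sl2_pair_wt a u v b : sl2_pair a u v -> Phi b ->
  wt b (lie u v) = (oct_inner b a)%:C%C.
Proof.
move=> [ra ua va t2] rb; have := wt_lie ra rb ua va.
by rewrite t2 mulrC => /(mulIf _) -> //; rewrite pnatr_eq0.
Qed.

(** After subtracting a multiple of u from x, the result y satisfies [y, v] = 0. As
2 a is not a root, [u, y] = 0 too, so that 2 y = [[u, v], y] = 0. *)
Lemma sl2_pair_line a u v (x : L) : sl2_pair a u v -> x \in W a ->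
  exists c : C, x = c *: u.
Proof.
move=> [ra ua va t2] xa.
pose c := wt a (lie x v) / 2; exists c; apply/eqP; rewrite -subr_eq0; apply/eqP.
set y := x - c *: u; have ya : y \in W a := memvB xa (memvZ c ua).
have yv : lie y v = 0.
  apply: (lie_opposite_eq0 ra ya va).
  rewrite /y lieDl lieNl lieZl wt_rD wt_rN wt_rZ t2 divfK ?subrr //.
  by rewrite pnatr_eq0.
have uy : lie u y = 0.
  by apply: (lie_root0 ra ra _ ua ya); rewrite (E8_root_norm ra) ler0n.
have := lie_leibniz u v y; rewrite uy lie0r addr0 (lieC v) yv oppr0 lie0r.
rewrite (lieH (lie_opposite_H ua va) ya) t2 => /esym/eqP.
by rewrite scaler_eq0 pnatr_eq0 /= => /eqP.
Qed.

(** Here b - a is not a root, so ad v vanishes on W b and ad v ad u is the identity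
there. *)
Lemma sl2_pair_inj a u v b z : sl2_pair a u v -> Phi b -> oct_inner b a = -1 ->
  z \in W b -> lie u z = 0 -> z = 0.
Proof.
move=> uv rb ba zb uz; case: (uv) => ra ua va _.
have vz : lie v z = 0.
  apply: (lie_root0 (E8_rootN ra) rb _ va zb).
  by rewrite oct_innerNl oct_innerC ba opprK ler01.
have := lie_leibniz u v z; rewrite uz vz !lie0r addr0.
rewrite (lieH (lie_opposite_H ua va) zb) (sl2_pair_wt uv rb) ba => /esym/eqP.
by rewrite scaler_eq0 rmorphN1 oppr_eq0 oner_eq0 /= => /eqP.
Qed.

(** The reflection in a maps c to c - a. For t = [x, y], the bracket of [f, x] and
[e, y] is a(t) [e, f] - t, the opposite of the reflection of t; changing the sign of
[e, y] corrects this. *)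
Lemma sl2_pairB a c e f (x y : L) : sl2_pair a e f -> sl2_pair c x y ->
  oct_inner c a = 1 -> exists u v, sl2_pair (c - a) u v.
Proof.
move=> ef xy ca; case: (ef) => ra ea fa _; case: (xy) => rc xc yc _.
have rb : Phi (c - a) by apply/E8_rootB.
have rNa := E8_rootN ra; have rNc := E8_rootN rc.
have hH := lie_opposite_H ea fa; have tH := lie_opposite_H xc yc.
exists (lie f x), (- lie e y); split; first exact: rb.
- by rewrite addrC; exact: lieW fa xc.
- by rewrite memvN opprB; exact: lieW ea yc.
have xe : lie x e = 0 by apply: (lie_root0 rc ra _ xc ea); rewrite ca ler01.
have fy : lie f y = 0.
  apply: (lie_root0 rNa rNc _ fa yc).
  by rewrite oct_innerNl oct_innerNr oct_innerC ca opprK ler01.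
rewrite lieNr.
have -> : lie (lie f x) (lie e y) = wt a (lie x y) *: lie e f - lie x y.
  have := lie_leibniz f x (lie e y) => /eqP.
  rewrite -subr_eq => /eqP <-; congr (_ - _).
    rewrite (lie_leibniz x e) xe lie0l add0r (lieC e) (lieH tH ea).
    by rewrite lieNr lieZr (lieC f e) scalerN opprK.
  rewrite (lie_leibniz f e) fy lie0r addr0 (lieC f e) lieNl.
  rewrite (lieH hH yc) wtN (sl2_pair_wt ef rc) ca.
  by rewrite -scaleNr opprK scale1r.
rewrite wt_rN wt_rD wt_rN wt_rZ (sl2_pair_wt xy rb) (sl2_pair_wt xy ra) (sl2_pair_wt ef rb).
rewrite !oct_innerBl ca (oct_innerC a c) ca !E8_root_norm //.
by rewrite !rmorphB /= realC2 ?rmorph1; ring.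
Qed.

(** The roots for which all brackets of W a with W (- a) vanish; sl2_pair_exists
excludes them. *)
Definition degenerate a : Prop := Phi a /\ forall u v, ~ sl2_pair a u v.

Lemma degenerate_lie a u v : degenerate a -> u \in W a -> v \in W (- a) -> lie u v = 0.
Proof.
move=> [ra nsl2] ua va; apply: contrapT => /eqP uv0.
by have [c] := sl2_pairP ra ua va uv0; apply: nsl2.
Qed.

Lemma not_degenerate a : Phi a -> ~ degenerate a -> exists u v, sl2_pair a u v.
Proof.
move=> ra nbad; apply: contrapT => nsl2; apply: nbad; split=> // u v uv.
by apply: nsl2; exists u, v.
Qed.

(** If a were not degenerate, then neither would be b = (a + b) - a, by sl2_pairB.
If both a and b are degenerate, the Leibniz rule shows that [u, v] commutes with W
(- (a + b)), which is impossible for a nonzero vector of W (a + b). *)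
Lemma degenerate_lie_regular a b u v : Phi a -> degenerate b -> Phi (a + b) ->
  ~ degenerate (a + b) -> u \in W a -> v \in W b -> lie u v = 0.
Proof.
move=> ra bb rc nbc ua vb; have [rb nsl2] := bb.
have [e [f ef]] := not_degenerate rc nbc; have [_ ec fc _] := ef.
have ba : degenerate a.
  apply: contrapT => nba; have [x [y xy]] := not_degenerate ra nba.
  have ca : oct_inner (a + b) a = 1.
    rewrite oct_innerDl E8_root_norm // oct_innerC.
    by move/(E8_rootD ra rb): rc => ->; ring.
  have [g [k gk]] := sl2_pairB xy ef ca.
  by move: gk; rewrite addrC addKr => /nsl2.
have [c uvE] := sl2_pair_line ef (lieW ua vb).
have lie0 : lie (lie u v) f = 0.
  have vf : lie v f \in W (- a).
    by have := lieW vb fc; rewrite opprD addrCA subrr addr0.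
  have uf : lie u f \in W (- b).
    by have := lieW ua fc; rewrite opprD addrA subrr add0r.
  have := lie_leibniz u v f; rewrite (degenerate_lie ba ua vf) (degenerate_lie bb vb uf) addr0.
  by move/esym.
have c0 : c * 2 = 0.
  have [_ _ _ t2] := ef.
  by rewrite -t2 -wt_rZ -lieZl -uvE lie0 wt_r0.
move/eqP: c0; rewrite mulf_eq0 pnatr_eq0 orbF => /eqP c0.
by rewrite uvE c0 scale0r.
Qed.

Definition degenerate_roots : seq (octonion R) :=
  [seq b <- E8_list R | `[< degenerate b >]].

Lemma degenerate_rootsP b : b \in degenerate_roots <-> degenerate b.
Proof.
rewrite mem_filter; split=> [/andP[/asboolP]//|bb].
by rewrite (asboolT bb); apply/E8_listP; case: bb.
Qed.

Lemma degenerate_roots_uniq : uniq degenerate_roots.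
Proof. by rewrite filter_uniq ?E8_list_uniq. Qed.

Lemma degenerate_ideal : bracket_in fullv
  (\sum_(b <- degenerate_roots) W b)%VS (\sum_(b <- degenerate_roots) W b)%VS.
Proof.
set N := (\sum_(b <- _) _)%VS.
have sub b v : degenerate b -> v \in W b -> v \in N.
  by move=> /degenerate_rootsP bs; apply/subvP; rewrite /N (big_rem b bs) addvSl.
move=> u v _ /(memv_sum_seqP _ _ degenerate_roots_uniq)[y yW ->].
rewrite [lie _ _]linear_sum big_seq; apply: memv_suml => b bs /=.
have bb : degenerate b by apply/degenerate_rootsP.
have rb : Phi b by case: bb.
have {yW} := yW b bs; move: (y b) => {y bs} z zb.
have [x xW ->] := rootW_decomposition u.
rewrite lie_suml_seq big_seq; apply: memv_suml => a as_.
have {xW} := xW a as_; move: (x a) => {x u} w wa.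
move: as_; rewrite inE => /orP[/eqP a0|/E8_listP ra].
  by apply: (sub b _ bb); have := lieW wa zb; rewrite a0 add0r.
have [/eqP|ab0] := eqVneq (a + b) 0.
  rewrite addr_eq0 => /eqP ab; rewrite ab in wa.
  by rewrite lieC (degenerate_lie bb zb wa) oppr0 mem0v.
have [rc|nrc] := pselect (Phi (a + b)); last first.
  by rewrite (W_nonroot (lieW wa zb) ab0 nrc) mem0v.
have [bc|nbc] := pselect (degenerate (a + b)); first exact: (sub _ _ bc (lieW wa zb)).
by rewrite (degenerate_lie_regular ra bb rc nbc wa zb) mem0v.
Qed.

Lemma H_neq0 : exists2 h, h \in H & h != 0.
Proof.
have := rho_inj; apply: contraPP => H0 inj.
case/negP: (E8_root_neq0 (E8_root_one R)).
apply/eqP/inj/lfunP => h; have -> : h = 0; last by rewrite !linear0.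
apply: val_inj; rewrite linear0; apply: contrapT => /eqP h0; apply: H0.
by exists (vsval h); rewrite ?subvsP.
Qed.

(** The ideal spanned by the degenerate root spaces is not the whole algebra, as it
does not contain H, so it is 0. *)
Lemma sl2_pair_exists a : Phi a -> exists u v, sl2_pair a u v.
Proof.
move=> ra; apply: (not_degenerate ra) => ba.
have as_ : a \in degenerate_roots by apply/degenerate_rootsP.
have [z za z0] := root_exists ra.
case: simpleL => _ _ /(_ _ (subvf _) degenerate_ideal) [N0|Nf].
  case/negP: z0; rewrite -memv0 -N0 (big_rem a as_).
  exact: (subvP (addvSl _ _) _ za).
have [h hH h0] := H_neq0; case/negP: h0.
have /(memv_sum_seqP _ _ degenerate_roots_uniq)[x xW hE] :
    h \in (\sum_(b <- degenerate_roots) W b)%VS.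
  by rewrite Nf memvf.
have s0 : 0 \notin degenerate_roots.
  by apply/negP => /degenerate_rootsP[/E8_root_neq0]; rewrite eqxx.
pose y b := if b == 0 then - h else x b.
have us : uniq (0 :: degenerate_roots) by rewrite cons_uniq s0 degenerate_roots_uniq.
have yW : {in 0 :: degenerate_roots, forall b, y b \in W b}.
  move=> b; rewrite inE /y; case: eqP => [-> _|_ /= bs]; last exact: xW.
  by rewrite memvN wspace0; exact: hH.
have ysum : \sum_(b <- 0 :: degenerate_roots) y b = 0.
  rewrite big_cons {1}/y eqxx hE addrC; apply/eqP; rewrite subr_eq0; apply/eqP.
  by apply: eq_big_seq => b bs; rewrite /y (negPf (memPn s0 b bs)).
have := W_independent us yW ysum (mem_head _ _).
by rewrite /y eqxx => /eqP; rewrite oppr_eq0.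
Qed.

(** * Coroots *)

Lemma oct_expand x : x = \sum_(p < 8) x 0 p *: oct_unit R p.
Proof.
apply/rowP => q; rewrite summxE (bigD1 q) //= big1 ?addr0 => [|p pq].
  by rewrite !mxE eqxx mulr1.
by rewrite !mxE eq_sym [_ == _](negPf pq) mulr0.
Qed.

Lemma wt_expand x h : wt x h = \sum_(p < 8) (x 0 p)%:C%C * wt (oct_unit R p) h.
Proof.
rewrite {1}[x]oct_expand.
elim/big_rec2: _ => [|p y1 y2 _ <-]; first exact: wt0.
by rewrite wtDZ.
Qed.

Definition coroot a : L :=
  xget 0 [set h | exists u v, sl2_pair a u v /\ h = lie u v].

Lemma corootP a : Phi a -> exists u v, sl2_pair a u v /\ coroot a = lie u v.
Proof.
move=> ra; have [u [v uv]] := sl2_pair_exists ra; rewrite /coroot.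
by apply: (@xgetPex _ 0 [set h | exists u v, sl2_pair a u v /\ h = lie u v]);
   exists (lie u v), u, v.
Qed.

Lemma coroot_H a : Phi a -> coroot a \in H.
Proof. by move=> /corootP[u [v [[_ ua va _] ->]]]; exact: lie_opposite_H ua va. Qed.

(** The formula is known for roots, among which the basis units; it extends to all x
by linearity over the reals. *)
Lemma wt_coroot x a : Phi a -> wt x (coroot a) = (oct_inner x a)%:C%C.
Proof.
move=> ra; have [u [v [uv ->]]] := corootP ra.
rewrite wt_expand oct_innerE rmorphM /= realC2 rmorph_sum mulr_sumr.
apply: eq_bigr => p _ /=; rewrite (sl2_pair_wt uv (E8_root_unit R p)).
by rewrite oct_innerC oct_inner_unit !rmorphM /= realC2; ring.
Qed.

Lemma W_line a : Phi a -> exists2 e, e != 0 & W a = <[e]>%VS.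
Proof.
move=> ra; have [u [v uv]] := sl2_pair_exists ra; exists u.
  apply/eqP => u0; case: (uv) => _ _ _ /eqP; rewrite u0 lie0l wt_r0 eq_sym.
  by rewrite pnatr_eq0.
apply/vspaceP => x; apply/idP/vlineP => [|[c ->]].
  exact: sl2_pair_line uv.
by have [_ ua _ _] := uv; exact: memvZ ua.
Qed.

Lemma dimW a : Phi a -> \dim (W a) = 1%N.
Proof. by move=> /W_line[e e0 ->]; rewrite dim_vline e0. Qed.

Lemma W_colinear a u v : Phi a -> u \in W a -> u != 0 -> v \in W a ->
  exists c : C, v = c *: u.
Proof.
move=> /W_line[e e0 ->] /vlineP[c ->] ce0 /vlineP[d ->].
have c0 : c != 0 by apply: contraNneq ce0 => ->; rewrite scale0r.
by exists (d / c); rewrite scalerA divfK.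
Qed.

Lemma lieW_neq0 a b u v : Phi a -> Phi b -> oct_inner a b = -1 ->
  u \in W a -> u != 0 -> v \in W b -> v != 0 -> lie u v != 0.
Proof.
move=> ra rb ab ua u0 vb; apply: contra_neq => uv0.
have [e [f ef]] := sl2_pair_exists ra; have [_ ea _ _] := ef.
have [c eE] := W_colinear ra ua u0 ea.
apply: (sl2_pair_inj ef rb _ vb); first by rewrite oct_innerC.
by rewrite eE lieZl uv0 scaler0.
Qed.

(** Both W a and W (a + b) are lines. *)
Lemma lieW_surj a b u w : Phi a -> Phi b -> oct_inner a b = -1 ->
  u \in W b -> u != 0 -> w \in W (a + b) -> exists2 v, v \in W a & w = lie v u.
Proof.
move=> ra rb ab ub u0 wab; have rab : Phi (a + b) by apply/E8_rootD.
have [v va v0] := root_exists ra.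
have [c ->] := W_colinear rab (lieW va ub) (lieW_neq0 ra rb ab va v0 ub u0) wab.
by exists (c *: v); [exact: memvZ va|rewrite lieZl].
Qed.

Lemma coroot_lie a u : Phi a -> u \in W a -> u != 0 ->
  exists2 v, v \in W (- a) & coroot a = lie u v.
Proof.
move=> ra ua u0; have [e [f [ef ->]]] := corootP ra; have [_ ea fa _] := ef.
have [c ->] := W_colinear ra ua u0 ea.
by exists (c *: f); [exact: memvZ fa|rewrite lieZl lieZr].
Qed.

(** The two sides have the same values under the weights of the basis units, hence
under all roots, so their difference is central. *)
Lemma H_coroots h : h \in H ->
  h = \sum_(p < 8) (wt (oct_unit R p) h / 2) *: coroot (oct_unit R p).
Proof.
move=> hH; apply/eqP; rewrite -subr_eq0; apply/eqP; apply: H_central.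
  apply: memvB hH _; apply: memv_suml => p _; apply: memvZ.
  exact/coroot_H/E8_root_unit.
suff unit0 (q : 'I_8) : wt (oct_unit R q) (h - \sum_(p < 8)
    (wt (oct_unit R p) h / 2) *: coroot (oct_unit R p)) = 0.
  by move=> a _; rewrite wt_expand big1 // => q _; rewrite unit0 mulr0.
rewrite wt_rD wt_rN (_ : wt _ (\sum_(p < 8) _) =
    \sum_(p < 8) wt (oct_unit R p) h / 2 * wt (oct_unit R q) (coroot (oct_unit R p))).
  rewrite (bigD1 q) //= big1 ?addr0 => [|p pq].
    rewrite wt_coroot; last exact: E8_root_unit.
    rewrite E8_root_norm; last exact: E8_root_unit.
    by rewrite realC2 divfK ?subrr // pnatr_eq0.
  rewrite wt_coroot; last exact: E8_root_unit.
  by rewrite oct_inner_unit mxE [_ == _](negPf pq) mulr0 rmorph0 mulr0.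
elim/big_rec2: _ => [|p y1 y2 _ <-]; first exact: wt_r0.
by rewrite wt_rD wt_rZ.
Qed.

Lemma H_ext h k : h \in H -> k \in H ->
  (forall p : 'I_8, wt (oct_unit R p) h = wt (oct_unit R p) k) -> h = k.
Proof.
move=> hH kH hk; rewrite [h]H_coroots // [k in RHS]H_coroots //.
by apply: eq_bigr => p _; rewrite hk.
Qed.

(** * Sums of root spaces, and the gradings *)

Definition wsum (P : pred (octonion R)) : {vspace L} :=
  (\sum_(b <- all_weights | P b) W b)%VS.

(** The components are indexed by a filtered sequence, the form needed by
W_independent. *)
Lemma mem_wsumP P v : reflect
  (exists2 x : octonion R -> L, {in [seq b <- all_weights | P b], forall b, x b \in W b} &
     v = \sum_(b <- [seq b <- all_weights | P b]) x b)
  (v \in wsum P).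
Proof.
by rewrite /wsum -big_filter; apply: memv_sum_seqP; rewrite filter_uniq ?all_weights_uniq.
Qed.

Lemma W_wsum (P : pred (octonion R)) b : b \in all_weights -> P b -> (W b <= wsum P)%VS.
Proof.
move=> bw Pb; rewrite /wsum -big_filter (big_rem b) ?addvSl //.
by rewrite mem_filter Pb.
Qed.

Lemma eq_wsum (P Q : pred (octonion R)) :
  {in all_weights, P =1 Q} -> wsum P = wsum Q.
Proof.
move=> PQ; rewrite /wsum big_seq_cond [RHS]big_seq_cond; apply: eq_bigl => b.
by apply: andb_id2l => bw; rewrite PQ.
Qed.

Lemma wsum_bracket (P Q T : pred (octonion R)) :
  (forall a b, a \in all_weights -> b \in all_weights -> P a -> Q b ->
     a + b \in all_weights -> T (a + b)) ->
  bracket_in (wsum P) (wsum Q) (wsum T).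
Proof.
move=> PQT u v /mem_wsumP[x xW ->] /mem_wsumP[y yW ->].
rewrite lie_suml_seq big_seq; apply: memv_suml => a as_.
rewrite [lie _ _]linear_sum big_seq; apply: memv_suml => b bs /=.
have := lieW (xW a as_) (yW b bs).
move: as_ bs; rewrite !mem_filter => /andP[Pa aw] /andP[Qb bw] xyW.
have [abw|abw] := boolP (a + b \in all_weights).
  exact: (subvP (W_wsum abw (PQT a b aw bw Pa Qb abw)) _ xyW).
rewrite (W_nonroot xyW) ?mem0v //.
  by apply: contraNneq abw => ->; exact: mem_head.
by move=> /E8_listP rab; rewrite inE rab orbT in abw.
Qed.

(** The sum is direct by W_independent. *)
Lemma dim_wsum P : \dim (wsum P) = (\sum_(b <- all_weights | P b) \dim (W b))%N.
Proof.
rewrite /wsum -!(big_filter all_weights).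
have us : uniq [seq b <- all_weights | P b] by rewrite filter_uniq ?all_weights_uniq.
elim: (filter _ _) us => [|a s IHs] /=; first by rewrite !big_nil dimv0.
case/andP=> a_s us; rewrite !big_cons -IHs //; apply: dimv_disjoint_sum.
apply/eqP; rewrite -subv0; apply/subvP => v.
rewrite memv_cap => /andP[va /(memv_sum_seqP _ _ us)[x xW vE]].
pose y b := if b == a then - v else x b.
have yW : {in a :: s, forall b, y b \in W b}.
  move=> b; rewrite inE /y; case: eqP => [-> _|_ /= bs]; last exact: xW.
  by rewrite memvN; exact: va.
have ysum : \sum_(b <- a :: s) y b = 0.
  rewrite big_cons {1}/y eqxx {1}vE addrC; apply/eqP; rewrite subr_eq0; apply/eqP.
  by apply: eq_big_seq => b bs; rewrite /y (negPf (memPn a_s b bs)).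
have uas : uniq (a :: s) by rewrite cons_uniq a_s us.
have := W_independent uas yW ysum (mem_head _ _).
by rewrite /y eqxx => /eqP; rewrite oppr_eq0 memv0.
Qed.

(** A function on the weights partitions the root space decomposition. *)
Lemma wsum_direct (I : finType) (f : octonion R -> I) :
  direct_sum fullv (fun i => wsum (fun b => f b == i)).
Proof.
have fullE : fullv = (\sum_i wsum (fun b => f b == i))%VS.
  by rewrite full_wspaces (partition_big f xpredT).
split=> //; rewrite directvE /= -fullE.
have -> : fullv = wsum xpredT by rewrite full_wspaces.
rewrite dim_wsum (partition_big f xpredT) //=.
by apply/eqP/eq_bigr => i _; rewrite dim_wsum.
Qed.

Local Notation alpha := (oct_one R).
Local Notation g := (e8_component rho alpha).

Lemma W_disjoint a b v : v \in W a -> v \in W b -> a != b -> v = 0.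
Proof.
move=> va vb ab; have [h hH hab] := wt_separates ab.
have := lieH hH va; rewrite (lieH hH vb) => /eqP.
by rewrite eq_sym -subr_eq0 -scalerBl scaler_eq0 subr_eq0 (negPf hab) => /eqP.
Qed.

Lemma wsumU (P Q : pred (octonion R)) :
  {in all_weights, forall b, P b -> ~~ Q b} ->
  direct_sum2 (wsum (predU P Q)) (wsum P) (wsum Q).
Proof.
move=> PQ.
have split_cond (T : Type) (idx : T) (op : Monoid.com_law idx) (F : octonion R -> T) :
    \big[op/idx]_(b <- all_weights | P b || Q b) F b =
    op (\big[op/idx]_(b <- all_weights | P b) F b)
       (\big[op/idx]_(b <- all_weights | Q b) F b).
  rewrite big_seq_cond [in RHS]big_seq_cond [X in op _ X]big_seq_cond.
  rewrite (bigID P) /=; congr (op _ _); apply: eq_bigl => b.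
    by rewrite -andbA andb_orl andbb; case: (P b); rewrite /= ?andbF ?andbT ?orbT.
  case bw : (b \in all_weights) => //=; case Pb : (P b) => //=; last by rewrite andbT.
  by rewrite (negPf (PQ b bw Pb)).
have sumE : wsum (predU P Q) = (wsum P + wsum Q)%VS by rewrite /wsum split_cond.
split=> //; rewrite directvE /= -sumE !dim_wsum.
by rewrite (split_cond _ _ addn).
Qed.

(** The floor only serves to read the integer <b, 1> off a real number. *)
Definition degree b : int := Num.floor (oct_inner b alpha).

Lemma degree_level b p : E8_level R p b -> degree b = p.
Proof. by move=> [_ /= e]; rewrite /degree e intrKfloor. Qed.

Lemma level_degree b : b \in E8_list R -> E8_level R (degree b) b.
Proof. by move=> /E8_listP/E8_level_values[p _ lb]; rewrite (degree_level lb). Qed.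

Lemma degree0 : degree 0 = 0.
Proof. by rewrite /degree oct_inner0l -[0]/(0%:~R) intrKfloor. Qed.

Lemma degreeE b : b \in all_weights -> oct_inner b alpha = (degree b)%:~R.
Proof.
rewrite inE => /orP[/eqP ->|bs]; first by rewrite degree0 oct_inner0l.
by case: (level_degree bs).
Qed.

Lemma degree_values b : b \in all_weights -> degree b \in [:: 2; 1; 0; -1; -2].
Proof.
rewrite inE => /orP[/eqP ->|/E8_listP rb]; first by rewrite degree0.
by have [p p5 /degree_level ->] := E8_level_values rb.
Qed.

Lemma degreeD a b : a \in all_weights -> b \in all_weights -> a + b \in all_weights ->
  degree (a + b) = degree a + degree b.
Proof.
move=> aw bw abw; apply/(@intr_inj R).
by rewrite intrD -!degreeE // oct_innerDl.
Qed.

Lemma all_weights_level p b : p != 0 -> b \in all_weights -> degree b = p -> E8_level R p b.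
Proof.
move=> p0; rewrite inE => /orP[/eqP ->|bs <-]; last exact: level_degree.
by rewrite degree0 => e; rewrite -e eqxx in p0.
Qed.

Lemma level_all_weights p b : E8_level R p b -> b \in all_weights.
Proof. by move=> [/E8_listP rb _]; rewrite inE rb orbT. Qed.

(** The weight 0, with weight space H, has degree 0. *)
Lemma componentE p : g p = wsum (fun b => degree b == p).
Proof.
rewrite /e8_component /wsum /all_weights big_cons degree0 eq_sym wspace0.
have -> : \big[addv/0%VS]_(b \in Phi `&` [set b | oct_inner b alpha = p%:~R])
    weight_space fullv (rho b) = (\sum_(b <- E8_list R | degree b == p) W b)%VS.
  have -> : Phi `&` [set b | oct_inner b alpha = p%:~R] =
      [set` [seq b <- E8_list R | degree b == p]].
    apply/seteqP; split=> b /=; rewrite mem_filter.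
      by move=> lb; rewrite (degree_level lb) eqxx /=; apply/E8_listP; case: lb.
    by move=> /andP[/eqP <- bs]; exact: level_degree.
  rewrite -fsbig_seq ?filter_uniq ?E8_list_uniq // big_filter.
  by apply: eq_bigr => b _; rewrite wspaceE.
by case: eqP => // _; rewrite add0v.
Qed.

Lemma level_count p : p != 0 ->
  count (fun b => degree b == p) all_weights = size (E8_level_list R p).
Proof.
move=> p0; rewrite -size_filter; apply: perm_size; apply: uniq_perm.
- by rewrite filter_uniq ?all_weights_uniq.
- exact: E8_level_list_uniq.
move=> b; rewrite mem_filter; apply/andP/idP => [[/eqP lb bw]|/E8_level_listP lb].
  exact/E8_level_listP/all_weights_level.
by rewrite (degree_level lb) (level_all_weights lb).
Qed.

Lemma dim_component p : p != 0 -> \dim (g p) = size (E8_level_list R p).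
Proof.
move=> p0; rewrite componentE dim_wsum -big_filter.
rewrite (eq_big_seq (fun=> 1%N)) => [|b]; first by rewrite sum1_size size_filter level_count.
rewrite mem_filter => /andP[/eqP lb bw].
by apply: dimW; have [] := all_weights_level p0 bw lb.
Qed.

Lemma component_graded : graded_by g.
Proof.
move=> p q; rewrite !componentE; apply: wsum_bracket => a b aw bw /eqP <- /eqP <- abw.
by rewrite degreeD.
Qed.

(** The position of a degree in the enumeration -2, ..., 2. *)
Definition degree5 b : 'I_5 := inord `|degree b + 2|.

Lemma degree5E b (p : 'I_5) : b \in all_weights -> (degree5 b == p) = (degree b == p%:Z - 2).
Proof.
move=> /degree_values; rewrite -val_eqE /degree5 /= !inE.
by case/or4P => [/eqP->|/eqP->|/eqP->|/orP[]/eqP->]; rewrite inordK //;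
  case: p => -[|[|[|[|[|//]]]]] lt_p.
Qed.

Lemma component_five_grading : five_grading g.
Proof.
split; first exact: component_graded.
- move=> p p2; rewrite componentE /wsum big_seq_cond big_pred0 // => b.
  apply/negP => /andP[/degree_values + /eqP e]; rewrite e !inE.
  by move=> /or4P[/eqP ep|/eqP ep|/eqP ep|/orP[]/eqP ep]; rewrite ep in p2.
have -> : (fun p : 'I_5 => g (p%:Z - 2)) = (fun p => wsum (fun b => degree5 b == p)).
  apply: funext => p; rewrite componentE; apply: eq_wsum => b bw /=.
  by rewrite degree5E.
exact: wsum_direct.
Qed.

Lemma mod3E (r : 'Z_3) : mod3_component g r = wsum (fun b => (degree b)%:~R == r).
Proof.
rewrite /mod3_component /wsum [RHS]big_seq_cond.
rewrite (partition_big degree5 (fun p : 'I_5 => ((p%:Z - 2)%:~R == r))) /=.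
  apply: eq_bigr => p /eqP pr; rewrite componentE /wsum big_seq_cond.
  apply: eq_bigl => b; case bw : (b \in all_weights) => //=.
  rewrite degree5E //; case: eqP => [->|_]; last by rewrite andbF.
  by rewrite pr eqxx.
move=> b /andP[bw lb].
have /eqP <- : degree b == (degree5 b)%:Z - 2 by rewrite -degree5E.
exact: lb.
Qed.

Lemma mod3_graded (r s : 'Z_3) :
  bracket_in (mod3_component g r) (mod3_component g s) (mod3_component g (r + s)).
Proof.
rewrite !mod3E; apply: wsum_bracket => a b aw bw /eqP <- /eqP <- abw.
by rewrite degreeD // intrD.
Qed.

Lemma mod3_direct : direct_sum fullv (mod3_component g).
Proof.
rewrite (_ : mod3_component g = fun r => wsum (fun b => (degree b)%:~R == r)).
  exact: wsum_direct.
by apply: funext => r; rewrite mod3E.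
Qed.

Lemma mod3_levels : {in all_weights, forall b,
  [/\ ((degree b)%:~R == 0 :> 'Z_3) = (degree b == 0),
      ((degree b)%:~R == 1 :> 'Z_3) = (degree b == 1) || (degree b == -2)
    & ((degree b)%:~R == 2 :> 'Z_3) = (degree b == -1) || (degree b == 2)]}.
Proof.
move=> b /degree_values; rewrite !inE.
by case/or4P => [/eqP->|/eqP->|/eqP->|/orP[]/eqP->]; split; vm_compute.
Qed.

Lemma mod3_0 : mod3_component g 0 = g 0.
Proof.
by rewrite mod3E componentE; apply: eq_wsum => b /mod3_levels[-> _ _].
Qed.

Lemma mod3_1 : direct_sum2 (mod3_component g 1) (g 1) (g (-2)).
Proof.
rewrite mod3E !componentE (@eq_wsum _
  (predU (fun b => degree b == 1) (fun b => degree b == -2))).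
  by apply: wsumU => b _ /eqP ->.
by move=> b /mod3_levels[_ -> _].
Qed.

Lemma mod3_2 : direct_sum2 (mod3_component g 2) (g (-1)) (g 2).
Proof.
rewrite mod3E !componentE (@eq_wsum _
  (predU (fun b => degree b == -1) (fun b => degree b == 2))).
  by apply: wsumU => b _ /eqP ->.
by move=> b /mod3_levels[_ _ ->].
Qed.

Lemma W_sub_wsum (P : pred (octonion R)) b : b \in all_weights -> W b != 0%VS ->
  (W b <= wsum P)%VS = P b.
Proof.
move=> bw Wb; apply/idP/idP => [sub|]; last exact: W_wsum.
apply: contraNT Wb => Pb.
have [_] : direct_sum2 (wsum (predU (pred1 b) P)) (wsum (pred1 b)) (wsum P).
  by apply: wsumU => a _ /eqP ->.
move=> /directv_addP cap0; rewrite -subv0 -cap0 subv_cap sub andbT.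
by apply: W_wsum => //=.
Qed.

(** A root space contained in the sum must be one of its summands, since root spaces
are independent. *)
Lemma root_spaces_wsum (P : pred (octonion R)) n : ~~ P 0 -> count P all_weights = n ->
  root_spaces_in H (wsum P) #= `I_n.
Proof.
move=> P0 <-; pose s := [seq b <- all_weights | P b].
have sP b : b \in s -> Phi b.
  rewrite mem_filter inE => /andP[Pb /orP[/eqP b0|/E8_listP//]].
  by rewrite b0 (negPf P0) in Pb.
rewrite -size_filter -/s -(size_map W); apply: card_uniq_seq.
  rewrite map_inj_in_uniq; first by rewrite filter_uniq ?all_weights_uniq.
  move=> a b as_ bs ab.
  have [v va v0] := root_exists (sP a as_).
  apply: contraNeq v0 => nab; apply/eqP; apply: (W_disjoint va _ nab).
  by rewrite -ab.
case: e8H => _ _ [_ _ im] U; split=> [[sub [mu rmu UE]]|/mapP[b bs ->]].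
  move: rmu; rewrite -im => -[b rb bmu].
  have bw : b \in all_weights by move/E8_listP: rb; rewrite inE orbC => ->.
  rewrite -bmu -wspaceE in UE; apply/mapP; exists b => //.
  by rewrite mem_filter bw andbT -(W_sub_wsum P bw (W_root rb)) -UE.
have rb := sP b bs; move: bs; rewrite mem_filter => /andP[Pb bw].
split; first exact: W_wsum.
by exists (rho b); rewrite -?wspaceE // -im; exists b.
Qed.

Lemma mod3_root_spaces : root_spaces_in H (mod3_component g 1) #= `I_57 /\
  root_spaces_in H (mod3_component g 2) #= `I_57.
Proof.
have [n2 n1 _ nm1 nm2] := E8_level_size R.
have count2 p q : p != q -> p != 0 -> q != 0 ->
    count (predU (fun b => degree b == p) (fun b => degree b == q)) all_weights =
    (size (E8_level_list R p) + size (E8_level_list R q))%N.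
  move=> pq p0 q0; rewrite -!level_count // -count_predUI.
  rewrite [X in (_ + X)%N](_ : _ = 0%N) ?addn0 //.
  apply/eqP; rewrite -leqn0 leqNgt -has_count; apply/hasPn => b _ /=.
  by apply/negP => /andP[/eqP -> /eqP e]; rewrite e eqxx in pq.
split; rewrite mod3E; apply: root_spaces_wsum; rewrite ?degree0 //.
  transitivity (size (E8_level_list R 1) + size (E8_level_list R (-2)))%N.
    by rewrite -count2 //; apply: eq_in_count => b /mod3_levels[].
  by rewrite n1 nm2.
transitivity (size (E8_level_list R (-1)) + size (E8_level_list R 2))%N.
  by rewrite -count2 //; apply: eq_in_count => b /mod3_levels[].
by rewrite nm1 n2.
Qed.

(** For b of degree -1, the root c = - 1 - b also has degree -1. The only root of
degree -2 is - 1, so bracketing with a vector of W c kills all the components of an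
element of g (-1) except the one at b, on which it is injective. *)
Lemma component_contact : contact_grading g.
Proof.
have [_ _ _ _ nm2] := E8_level_size R.
split; [exact: component_five_grading|by rewrite dim_component|].
rewrite componentE => v /mem_wsumP[x].
set s := filter _ _ => xW -> comm.
rewrite big_seq big1 // => b bs; have := xW b bs.
have r1 := E8_root_one R.
have [bw lb] : b \in all_weights /\ degree b = -1.
  by move: bs; rewrite mem_filter => /andP[/eqP].
have [rb /= binner] : E8_level R (-1) b by apply: all_weights_level.
have rNb := E8_rootN rb.
have rc : Phi (- alpha - b).
  by rewrite addrC; apply/(E8_rootB rNb r1); rewrite oct_innerNl binner mulrNz opprK.
have cinner : oct_inner (- alpha - b) alpha = -1.
  rewrite oct_innerBl oct_innerNl E8_root_norm // binner mulrNz opprK.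
  by rewrite -[2]/(1 + 1) opprD subrK.
have cw : - alpha - b \in all_weights.
  by apply: (@level_all_weights (-1)); split; rewrite //= cinner mulrNz.
have [y yc y0] := root_exists rc.
move=> xb; apply/eqP/negP => /negP xb0.
have yg : y \in wsum (fun b => degree b == -1).
  apply: (subvP (W_wsum cw _) _ yc).
  by rewrite /degree cinner -[X in Num.floor X]/((-1)%:~R) intrKfloor.
have /eqP := comm y yg; apply/negP.
rewrite lie_suml_seq (bigD1_seq b bs (filter_uniq _ all_weights_uniq)) /=.
rewrite big1_seq ?addr0 => [|c /andP[cb cs]].
  apply: (lieW_neq0 rb rc _ xb xb0 yc y0).
  rewrite oct_innerBr oct_innerNr binner E8_root_norm // mulrNz opprK.
  by rewrite -[2]/(1 + 1) opprD addrA subrr add0r.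
have clev : oct_inner c alpha = -1.
  by move: cs; rewrite mem_filter => /andP[/eqP lc /degreeE ->]; rewrite lc mulrNz.
have eqc : c + (- alpha - b) = - alpha -> c = b.
  by move/eqP; rewrite addrCA -subr_eq0 addrAC subrr add0r subr_eq0 => /eqP.
have level2 : oct_inner (c + (- alpha - b)) alpha = (-2)%:~R.
  by rewrite oct_innerDl clev cinner -opprD mulrNz.
apply: (W_nonroot (lieW (xW c cs) yc)) => [|rcb].
  apply: contra_eqN level2 => /eqP ->.
  by rewrite oct_inner0l eq_sym mulrNz oppr_eq0 pnatr_eq0.
case/negP: cb; apply/eqP/eqc.
have [_ /(congr1 (fun A : set _ => A (c + (- alpha - b))))] := E8_level_pm2 R.
by move=> /= e; rewrite -e; split.
Qed.

(** * The subalgebra e7 of degree 0 *)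

Let ea : L := vpick (W alpha).

Let eaW : ea \in W alpha.
Proof. exact: memv_pick. Qed.

Let ea0 : ea != 0.
Proof. by rewrite vpick0; apply/W_root/E8_root_one. Qed.

(** The centralizer of a root vector of alpha: it acts trivially on degree 2 by
construction, and the torus is cut out of H by the equation alpha(h) = 0. *)
Definition e7 : {vspace L} := (g 0 :&: lker (ad ea))%VS.

Definition e7_torus : {vspace L} := (e7 :&: H)%VS.
Local Notation T := e7_torus.

Lemma mem_e7 v : v \in e7 <-> v \in g 0 /\ lie ea v = 0.
Proof.
rewrite memv_cap memv_ker adE; split=> [/andP[v0 /eqP e]|[v0 e]]; first by split.
by rewrite v0 e eqxx.
Qed.

Lemma W_component p b : b \in all_weights -> degree b = p -> (W b <= g p)%VS.
Proof. by move=> bw lb; rewrite componentE; apply: W_wsum; rewrite // lb eqxx. Qed.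

Lemma H_component0 : (H <= g 0)%VS.
Proof. by rewrite -[X in (X <= _)%VS]wspace0; apply: W_component (mem_head _ _) degree0. Qed.

Lemma W_level p b : E8_level R p b -> (W b <= g p)%VS.
Proof. by move=> lb; apply: W_component (level_all_weights lb) (degree_level lb). Qed.

Lemma mem_e7_torus h : h \in T <-> h \in H /\ wt alpha h = 0.
Proof.
have lieE (k : L) : k \in H -> lie ea k = - (wt alpha k *: ea).
  by move=> kH; rewrite lieC (lieH kH eaW).
rewrite /T memv_cap; split=> [/andP[/mem_e7[_ e] hH]|[hH e]].
  split; first exact: hH.
  have /eqP := lieE h hH; rewrite e eq_sym oppr_eq0 scaler_eq0 (negPf ea0) orbF.
  by move/eqP.
apply/andP; split; last exact: hH.
apply/mem_e7; split; first exact: subvP H_component0 _ hH.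
by rewrite lieE // e scale0r oppr0.
Qed.

Lemma W_e7 b : E8_level R 0 b -> (W b <= e7)%VS.
Proof.
move=> lb; apply/subvP => v vb; apply/mem_e7; split; first exact: subvP (W_level lb) _ vb.
case: lb => rb /= b0; apply: (lie_root0 (E8_root_one R) rb _ eaW vb).
by rewrite oct_innerC b0.
Qed.

Lemma coroot_e7_torus b : E8_level R 0 b -> coroot b \in T.
Proof.
move=> [rb /= b0]; apply/mem_e7_torus; split; first exact: coroot_H.
by rewrite wt_coroot // oct_innerC b0.
Qed.

Lemma component2E : g 2 = <[ea]>%VS.
Proof.
have [n2 _ _ _ _] := E8_level_size R.
apply/esym/eqP; rewrite eqEdim dim_component // n2 dim_vline ea0 andbT.
rewrite -memvE; apply: (subvP (W_level _)) eaW; split; first exact: E8_root_one.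
by rewrite /= E8_root_norm //; exact: E8_root_one.
Qed.

Lemma lie_component0_ea v : v \in g 0 -> exists c : C, lie v ea = c *: ea.
Proof.
move=> v0; apply/vlineP; rewrite -component2E.
have eg : ea \in g 2 by rewrite component2E memv_line.
by have := component_graded v0 eg; rewrite add0r.
Qed.

Lemma component0_coroot v : v \in g 0 -> lie v (coroot alpha) = 0.
Proof.
have r1 := E8_root_one R.
rewrite componentE => /mem_wsumP[x xW ->].
rewrite lie_suml_seq big1_seq // => b /andP[_ bs].
rewrite lieC (lieH (coroot_H r1) (xW b bs)) wt_coroot //.
move: bs; rewrite mem_filter => /andP[/eqP lb /degreeE ->].
by rewrite lb mulr0z rmorph0 scale0r oppr0.
Qed.

Definition e7_center : {vspace L} := <[coroot alpha]>%VS.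
Local Notation Z := e7_center.

Lemma coroot_neq0 a : Phi a -> coroot a != 0.
Proof.
move=> ra; apply/eqP => e; have := wt_coroot a ra.
rewrite e wt_r0 E8_root_norm // => /eqP.
by rewrite realC2 eq_sym pnatr_eq0.
Qed.

Lemma lie_ea_coroot : lie ea (coroot alpha) = - (2 *: ea).
Proof.
have r1 := E8_root_one R.
by rewrite lieC (lieH (coroot_H r1) eaW) wt_coroot // E8_root_norm // realC2.
Qed.

(** The map [ea, .] sends g 0 to the line g 2 and does not kill the coroot of alpha;
e7 is its kernel. *)
Lemma component0_decomposition : direct_sum2 (g 0) e7 Z.
Proof.
have r1 := E8_root_one R.
have Zg : (Z <= g 0)%VS by rewrite -memvE; exact: subvP H_component0 _ (coroot_H r1).
split; last first.
  apply/directv_addP/eqP; rewrite -subv0; apply/subvP => v.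
  rewrite memv_cap => /andP[/mem_e7[_ e] /vlineP[c vE]]; move: e.
  rewrite vE lieZr lie_ea_coroot scalerN scalerA => /eqP.
  rewrite oppr_eq0 scaler_eq0 (negPf ea0) orbF mulf_eq0 pnatr_eq0 orbF => /eqP ->.
  by rewrite scale0r mem0v.
apply/eqP; rewrite eqEsubv subv_add Zg andbT capvSl andbT.
apply/subvP => v v0; have [c vea] := lie_component0_ea v0.
pose k := (c / 2) *: coroot alpha.
have kZ : k \in Z by apply: memvZ; exact: memv_line.
rewrite -[v](subrK k); apply: (memv_add _ kZ).
apply/mem_e7; split; first exact: memvB v0 (subvP Zg _ kZ).
rewrite lieDr lieNr /k lieZr lie_ea_coroot lieC vea.
by rewrite scalerN scalerA divfK ?pnatr_eq0 // opprK addNr.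
Qed.

(** The derivation ad ea vanishes on e7, and maps g 0 to multiples of ea, which
commute with e7. *)
Lemma component0_e7 : bracket_in (g 0) e7 e7.
Proof.
move=> u v u0 /mem_e7[v0 e]; apply/mem_e7; split.
  by have := component_graded u0 v0; rewrite addr0.
have [c uea] := lie_component0_ea u0.
by rewrite lie_leibniz e lie0r addr0 (lieC ea u) uea lieNl lieZl e scaler0 oppr0.
Qed.

Lemma component0_center : bracket_in (g 0) Z 0%VS.
Proof.
move=> u v u0 /vlineP[c ->].
by rewrite lieZr component0_coroot // scaler0 mem0v.
Qed.

Lemma e7_sub : (e7 <= g 0)%VS.
Proof. exact: capvSl. Qed.

Lemma e7_component2 : bracket_in e7 (g 2) 0%VS.
Proof.
move=> u v /mem_e7[_ e]; rewrite component2E => /vlineP[c ->].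
by rewrite lieZr lieC e oppr0 scaler0 mem0v.
Qed.

(** Elements of e7 commute with ea and with the coroot [ea, f], and multiply f by a
scalar, which has to be 0. *)
Lemma e7_componentN2 : bracket_in e7 (g (-2)) 0%VS.
Proof.
have r1 := E8_root_one R; have rN1 := E8_rootN r1.
have [f fW hE] := coroot_lie r1 eaW ea0.
have f0 : f != 0.
  by apply: contraNneq (coroot_neq0 r1) => f0; rewrite hE f0 lie0r.
have [_ _ _ _ nm2] := E8_level_size R.
have lN1 : E8_level R (-2) (- alpha).
  by have [_ ->] := E8_level_pm2 R.
have fg : f \in g (-2) := subvP (W_level lN1) _ fW.
have gE : g (-2) = <[f]>%VS.
  apply/esym/eqP; rewrite eqEdim dim_component // nm2 dim_vline f0 andbT.
  by rewrite -memvE.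
move=> u v ue; rewrite gE => /vlineP[c ->]; rewrite lieZr.
have u0 := subvP e7_sub _ ue; have /mem_e7[_ e] := ue.
have [d uf] : exists d : C, lie u f = d *: f.
  by apply/vlineP; rewrite -gE; have := component_graded u0 fg; rewrite add0r.
have := component0_coroot u0; rewrite hE lie_leibniz (lieC u ea) e oppr0 lie0l add0r.
rewrite uf lieZr -hE => /eqP; rewrite scaler_eq0 (negPf (coroot_neq0 r1)) orbF => /eqP ->.
by rewrite scale0r scaler0 mem0v.
Qed.

(** The restriction of rho x to the torus of e7. *)
Definition res x : dual_space T :=
  (rho x \o linfun (vsproj H) \o linfun (vsval : subvs_of T -> L))%VF.

Lemma resE x (u : subvs_of T) : res x u = wt x (vsval u) :> C.
Proof. by rewrite /res !comp_lfunE !lfunE. Qed.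

Lemma resZD (c : R) x y : res (c *: x + y) = c%:C%C *: res x + res y.
Proof.
apply/lfunP => u; rewrite add_lfunE scale_lfunE.
have := wtDZ c x y (vsval u); rewrite -!resE; exact.
Qed.

Lemma res0 : res 0 = 0.
Proof. by apply/lfunP => u; rewrite zero_lfunE; have := resE 0 u; rewrite wt0. Qed.

Lemma resD x y : res (x + y) = res x + res y.
Proof. by have := resZD 1 x y; rewrite !scale1r. Qed.

Lemma resZ (c : R) x : res (c *: x) = c%:C%C *: res x.
Proof. by have := resZD c x 0; rewrite res0 !addr0. Qed.

Lemma resN x : res (- x) = - res x.
Proof. by rewrite -scaleN1r resZ rmorphN1 scaleN1r. Qed.

Lemma resMn x n : res (x *+ n) = res x *+ n.
Proof.
elim: n => [|n IHn]; first by rewrite !mulr0n res0.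
by rewrite !mulrS resD IHn.
Qed.

Lemma e7_torus_H h : h \in T -> h \in H.
Proof. by move=> /mem_e7_torus[]. Qed.

Lemma res_proj x h : h \in T -> res x (vsproj T h) = wt x h :> C.
Proof. by move=> hT; rewrite resE vsprojK. Qed.

Lemma res_coroot x b : E8_level R 0 b ->
  res x (vsproj T (coroot b)) = (oct_inner x b)%:C%C :> C.
Proof.
by move=> lb; rewrite res_proj ?coroot_e7_torus // wt_coroot //; case: lb.
Qed.

(** The coroots of the imaginary units belong to the torus and determine all the
coordinates but the real one. *)
Lemma e7_wt_inj x y : oct_inner x alpha = oct_inner y alpha ->
  (forall h, h \in T -> wt x h = wt y h) -> x = y.
Proof.
move=> xy1 xy; apply/rowP => p.
have nz2 : 2 != 0 :> R by rewrite pnatr_eq0.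
apply: (mulfI nz2); have [->|p0] := eqVneq p ord0.
  by rewrite -!oct_inner_one.
have lp := E8_level_unit R p0.
have := xy _ (coroot_e7_torus lp); rewrite !wt_coroot; [|by case: lp|by case: lp].
by move=> /complexI; rewrite !oct_inner_unit.
Qed.

Lemma e7_separates x y : oct_inner x alpha = oct_inner y alpha -> x != y ->
  exists2 h, h \in T & wt x h != wt y h.
Proof.
move=> xy1 /eqP xy; apply: contrapT => sep; apply: xy; apply: e7_wt_inj => // h hT.
by apply: contrapT => e; apply: sep; exists h => //; apply/eqP.
Qed.

Lemma res_inj x y : oct_inner x alpha = oct_inner y alpha -> res x = res y -> x = y.
Proof.
move=> xy1 e; apply: e7_wt_inj => // h hT.
by rewrite -!res_proj // e.
Qed.

Lemma level_inj p a b : E8_level R p a -> E8_level R p b -> res a = res b -> a = b.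
Proof. by move=> [_ /= ap] [_ /= bp]; apply: res_inj; rewrite ap bp. Qed.

Lemma weight_e7P (M : {vspace L}) (mu : dual_space T) v :
  v \in weight_space M mu <->
  v \in M /\ forall h, h \in T -> lie h v = (mu (vsproj T h) : C) *: v.
Proof.
rewrite mem_weight_space; split=> -[vM e]; split; [exact: vM| |exact: vM|] => h.
  by move=> hT; rewrite -{1}(vsprojK hT) e.
by rewrite e ?vsvalK //; exact: subvsP.
Qed.

Lemma W_weight (M : {vspace L}) b : (W b <= M)%VS -> (W b <= weight_space M (res b))%VS.
Proof.
move=> bM; apply/subvP => v vb; apply/weight_e7P.
split=> [|h hT]; first exact: subvP bM _ vb.
by rewrite res_proj //; exact: lieH (e7_torus_H hT) vb.
Qed.

(** For v of weight mu with a nonzero component at b, the elements of the torus act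
on this component both by mu and by res b. *)
Lemma weights_component p (mu : dual_space T) (M : {vspace L}) : (M <= g p)%VS ->
  weight_space M mu != 0%VS ->
  exists2 b, b \in all_weights & degree b = p /\ mu = res b.
Proof.
move=> Mg Mmu; pose v := vpick (weight_space M mu).
have v0 : v != 0 by rewrite vpick0.
have /weight_e7P[vM ev] : v \in weight_space M mu by exact: memv_pick.
have := subvP Mg _ vM; rewrite componentE => /mem_wsumP[x].
set s := filter _ _ => xW vE.
have us : uniq s by rewrite filter_uniq ?all_weights_uniq.
have [b bs xb0] : exists2 b, b \in s & x b != 0.
  apply: contrapT => nob; case/eqP: v0; rewrite vE big1_seq // => b /andP[_ bs].
  by apply: contrapT => xb; apply: nob; exists b => //; apply/eqP.
have [/eqP lb bw] : degree b == p /\ b \in all_weights.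
  by move: bs; rewrite mem_filter => /andP[].
exists b => //; split=> //; apply/lfunP => u.
have uT : vsval u \in T by exact: subvsP.
pose y c := (wt c (vsval u) - (mu u : C)) *: x c.
have yW : {in s, forall c, y c \in W c} by move=> c cs; apply: memvZ; exact: xW.
have y0 : \sum_(c <- s) y c = 0.
  have := ev _ uT; rewrite vsvalK => /eqP; rewrite -subr_eq0 => /eqP ev0.
  rewrite -[RHS]ev0 vE [lie _ _]linear_sum scaler_sumr -sumrB; apply: eq_big_seq => c cs.
  by rewrite /= (lieH (e7_torus_H uT) (xW c cs)) -scalerBl.
have /eqP := W_independent us yW y0 bs.
rewrite scaler_eq0 (negPf xb0) orbF subr_eq0 => /eqP <-.
by have := resE b u => ->.
Qed.

Lemma level0_neq0 b : b \in all_weights -> degree b = 0 -> b != 0 -> E8_level R 0 b.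
Proof.
by rewrite inE => /orP[/eqP ->|bs <- _]; rewrite ?eqxx //; exact: level_degree.
Qed.

(** The roots of degree 0 stay nonzero on the torus, which contains their coroots. *)
Lemma e7_roots : root_set e7 T = res @` E8_level R 0.
Proof.
apply/seteqP; split=> [mu [mu0 wmu]|_ [b lb <-]].
  have [b bw [lb e]] := weights_component e7_sub wmu.
  exists b => //; apply: level0_neq0 => //.
  by apply: contraNneq mu0 => b0; rewrite e b0 res0.
have rb : Phi b by case: lb.
split.
  apply/eqP => e; have := res_coroot b lb; rewrite e zero_lfunE E8_root_norm //.
  by rewrite realC2 => /eqP; rewrite eq_sym pnatr_eq0.
apply: contraNneq (W_root rb) => e; rewrite -subv0 -e.
exact/W_weight/W_e7.
Qed.

(** The root of degree 0 with the given restriction to the torus, when there is one. *)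
Definition e7_root_of (mu : dual_space T) : octonion R :=
  xget 0 [set b | E8_level R 0 b /\ res b = mu].

Definition e7_pair (mu nu : dual_space T) : C :=
  mu (vsproj T (coroot (e7_root_of nu))).

Lemma e7_root_ofK b : E8_level R 0 b -> e7_root_of (res b) = b.
Proof.
move=> lb; rewrite /e7_root_of.
case: xgetP => [c _ [lc /(level_inj lc lb)]//|/(_ b)]; by case.
Qed.

Lemma e7_pairE x b : E8_level R 0 b -> e7_pair (res x) (res b) = (oct_inner x b)%:C%C.
Proof. by move=> lb; rewrite /e7_pair e7_root_ofK // res_coroot. Qed.

Lemma e7_pair_scalar nu : scalar (e7_pair^~ nu).
Proof. by move=> c x y; rewrite /e7_pair add_lfunE scale_lfunE. Qed.

Lemma realC_half (r : R) : (r / 2)%:C%C = r%:C%C / 2 :> C.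
Proof. by rewrite rmorphM fmorphV rmorph_nat. Qed.

(** The properties are transported from the octonions by res. Only proportionality
needs an argument: if c times a root is a root, evaluation at a coroot shows that
the complex number c is real. *)
Lemma e7_root_system : root_system_of_type E7_cartan (root_set e7 T) e7_pair.
Proof.
rewrite e7_roots; have [[fin _ _ _ mult] [d [[_ dl dcoord] dpair]]] := E7_level0 R.
have pair2 b : E8_level R 0 b -> e7_pair (res b) (res b) = 2.
  by move=> lb; rewrite e7_pairE // E8_root_norm ?realC2 //; case: lb.
split; first split.
- split; first by apply: finite_image; case: fin.
  move=> [b lb rb0]; have := pair2 b lb.
  rewrite rb0 /e7_pair zero_lfunE => /eqP; by rewrite eq_sym pnatr_eq0.
- by move=> _ [a la <-]; split; [exact: e7_pair_scalar|exact: pair2].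
- move=> _ _ [a la <-] [b lb <-]; exists (b - oct_inner b a *: a).
    exact: E8_level0_reflection.
  by rewrite e7_pairE // resD resN resZ.
- move=> _ _ [a [ra a0] <-] [b [rb b0] <-]; rewrite e7_pairE //.
  have [La _] := ra; have [Lb _] := rb.
  have /intrP[m ->] := E8_inner_int Lb La.
  by exists m; rewrite rmorph_int.
- move=> _ c [a la <-] [b lb e].
  have cE : c = (oct_inner b a / 2)%:C%C.
    have := e7_pairE b la; rewrite e /e7_pair e7_root_ofK // scale_lfunE.
    rewrite res_coroot // E8_root_norm; last by case: la.
    rewrite realC2 realC_half => <-.
    by rewrite [_ *: _]/(_ * _) mulfK // pnatr_eq0.
  have ba : b = (oct_inner b a / 2) *: a.
    apply: res_inj; last by rewrite resZ -cE.
    by case: la => _ /= la0; case: lb => _ /= lb0; rewrite oct_innerZl la0 lb0 mulr0.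
  rewrite cE; have [||->|->] := mult a (oct_inner b a / 2).
  + exact: la.
  + by rewrite -ba; exact: lb.
  + by left.
  + by right; rewrite rmorphN1.
pose d' := map_tuple res d.
have dE p : tnth d' p = res (tnth d p) by rewrite tnth_map.
have dpair' p q : e7_pair (tnth d' p) (tnth d' q) = (E7_cartan p q)%:~R.
  rewrite !dE e7_pairE // -(oct_pairing_root _ (dl q).1) dpair.
  by rewrite rmorph_int.
exists d'; split=> //; split.
- apply: (gram_free (pair := e7_pair)) dpair' E7_det => q; exact: e7_pair_scalar.
- by move=> p; rewrite dE; exists (tnth d p).
move=> _ [b /dcoord[c bE] <-]; exists c.
have sumE : res (\sum_(p < 7) tnth d p *+ c p) = \sum_(p < 7) tnth d' p *+ c p.
  elim/big_rec2: _ => [|p y1 y2 _ <-]; first exact: res0.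
  by rewrite resD resMn dE.
by case: bE => ->; [left|right]; rewrite ?resN sumE.
Qed.

(** * Simplicity of e7 and its 56-dimensional modules *)

(** Weights of the same degree have distinct restrictions to the torus. *)
Lemma e7_components p (N : {vspace L}) (x : octonion R -> L) :
  let s := [seq b <- all_weights | degree b == p] in
  bracket_in e7 N N -> {in s, forall b, x b \in W b} -> \sum_(b <- s) x b \in N ->
  {in s, forall b, x b \in N}.
Proof.
move=> s eN xW; apply: (@stable_components _ _ _ wt (fun h => h \in T) (fun v => v \in N)).
- by move=> c u v uN vN; apply: memvD vN; exact: memvZ uN.
- by move=> h v hT; apply: eN; exact: subvP (capvSl _ _) _ hT.
- by rewrite filter_uniq ?all_weights_uniq.
- move=> a b as_ bs; apply: e7_separates; move: as_ bs; rewrite !mem_filter.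
  by move=> /andP[/eqP la /degreeE ->] /andP[/eqP lb /degreeE ->]; rewrite la lb.
- by move=> b bs h hT; exact: lieH (e7_torus_H hT) (xW b bs).
Qed.

Lemma submodule_has_W p (N : {vspace L}) : p != 0 -> (N <= g p)%VS ->
  bracket_in e7 N N -> N != 0%VS -> exists2 b, E8_level R p b & (W b <= N)%VS.
Proof.
move=> p0 Ng eN N0; pose v := vpick N.
have v0 : v != 0 by rewrite vpick0.
have vN : v \in N by exact: memv_pick.
have := subvP Ng _ vN; rewrite componentE => /mem_wsumP[x xW vE].
have sumN : \sum_(b <- [seq b <- all_weights | degree b == p]) x b \in N by rewrite -vE.
have xN := e7_components eN xW sumN.
have [b bs xb0] : exists2 b, b \in [seq b <- all_weights | degree b == p] & x b != 0.
  apply: contrapT => nob; case/eqP: v0; rewrite vE big1_seq // => b /andP[_ bs].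
  by apply: contrapT => xb; apply: nob; exists b => //; apply/eqP.
have [/eqP lb bw] : degree b == p /\ b \in all_weights.
  by move: (bs); rewrite mem_filter => /andP[].
have lpb := all_weights_level p0 bw lb; exists b; first exact: lpb.
have rb : Phi b by case: lpb.
apply/subvP => w wb; have [c ->] := W_colinear rb (xW b bs) xb0 wb.
apply: memvZ; exact: xN.
Qed.

(** A nonzero submodule contains the root space of some b, and the roots of e7 lead
from b to all the roots of the same degree. *)
Lemma e7_irreducible s : s \in [:: 1; -1] -> irreducible_module e7 (g s).
Proof.
move=> s1; have s0 : s != 0 by move: s1; rewrite !inE => /orP[]/eqP->.
have [n2 n1 n0 nm1 nm2] := E8_level_size R.
have ss : (0 < size (E8_level_list R s))%N.
  by move: s1; rewrite !inE => /orP[]/eqP->; rewrite ?n1 ?nm1.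
split.
- by rewrite -dimv_eq0 dim_component // -lt0n.
- move=> u v ue vs; have := component_graded (subvP e7_sub _ ue) vs.
  by rewrite add0r.
move=> N Ns eN; have [N0|N0] := eqVneq N 0%VS; [by left|right].
have [b0 lb0 Wb0] := submodule_has_W s0 Ns eN N0.
have step x a : E8_level R s x -> E8_level R 0 a -> oct_inner x a = -1 ->
    (W x <= N)%VS -> (W (x + a) <= N)%VS.
  move=> [rx _] la xa WxN; have ra : Phi a by case: la.
  have [u ux u0] := root_exists rx.
  apply/subvP => w; rewrite addrC => wxa.
  have ax : oct_inner a x = -1 by rewrite oct_innerC.
  have [v va ->] := lieW_surj ra rx ax ux u0 wxa.
  exact: eN (subvP (W_e7 la) _ va) (subvP WxN _ ux).
apply/eqP; rewrite eqEsubv Ns /= componentE /wsum -big_filter.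
apply/subvP => v /(memv_sum_seqP _ _ (filter_uniq _ all_weights_uniq))[x xW ->].
rewrite big_seq; apply: memv_suml => b bs; have xb := xW b bs.
move: bs; rewrite mem_filter => /andP[/eqP lb bw].
have lsb := all_weights_level s0 bw lb.
exact: subvP (gosset_connected s1 step lb0 lsb Wb0) _ xb.
Qed.

(** The edges of the Gosset graph are reflections, so the weights form a single
orbit; conversely, reflections in roots orthogonal to alpha preserve the degree. *)
Lemma e7_weights s : s \in [:: 1; -1] -> exists mu : dual_space T,
  forall nu, weights T (g s) nu <-> weyl_conjugate (root_set e7 T) e7_pair mu nu.
Proof.
move=> s1; have s0 : s != 0 by move: s1; rewrite !inE => /orP[]/eqP->.
have [n2 n1 n0 nm1 nm2] := E8_level_size R.
have [b0 lb0] : exists b, E8_level R s b.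
  have ss : (0 < size (E8_level_list R s))%N.
    by move: s1; rewrite !inE => /orP[]/eqP->; rewrite ?n1 ?nm1.
  exists (nth 0 (E8_level_list R s) 0); apply/E8_level_listP; exact: mem_nth.
exists (res b0) => nu; rewrite e7_roots; split=> [wnu|].
  have [b bw [lb ->]] := weights_component (subvv _) wnu.
  have lsb := all_weights_level s0 bw lb.
  apply: (gosset_connected (P := fun b => weyl_conjugate _ e7_pair (res b0) (res b))
            s1 _ lb0 lsb); last exact: weyl_refl.
  move=> x a lx la xa conj.
  have -> : res (x + a) = res x - e7_pair (res x) (res a) *: res a.
    by rewrite e7_pairE // xa rmorphN1 scaleN1r opprK resD.
  by apply: weyl_step conj; exists a.
move=> conj; have [b lb ->] : exists2 b, E8_level R s b & nu = res b.
  elim: conj => [|_ y [a la <-] _ [b lb ->]]; first by exists b0.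
  exists (b - oct_inner b a *: a); first exact: E8_level0_reflection.
  by rewrite e7_pairE // resD resN resZ.
have rb : Phi b by case: lb.
rewrite /weights /=; apply: contraNneq (W_root rb) => e; rewrite -subv0 -e.
exact/W_weight/W_level.
Qed.

Lemma e7_minuscule s : s \in [:: 1; -1] -> minuscule_module e7 e7_pair (g s).
Proof. by move=> s1; split; [exact: e7_irreducible|exact: e7_weights]. Qed.

(** A nonzero ideal contains a root space: otherwise it would lie in the torus,
where no nonzero element is killed by all the roots. With W a it contains the coroot
of a, and then every W b with <a, b> <> 0. *)
Lemma e7_simple : simple_subalgebra e7.
Proof.
split; first by move=> u v ue; apply: component0_e7; exact: subvP e7_sub _ ue.
  move=> ab.
  have l1 := @E8_level_unit R (inord 1) _.
  have p0 : (inord 1 : 'I_8) != ord0 by rewrite -val_eqE /= inordK.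
  have {}l1 := l1 p0; have r1 : Phi (oct_unit R (inord 1 : 'I_8)) by case: l1.
  have [u ub u0] := root_exists r1.
  have cT := coroot_e7_torus l1; have cE := subvP (capvSl _ _) _ cT.
  have := ab _ _ cE (subvP (W_e7 l1) _ ub).
  rewrite memv0 (lieH (coroot_H r1) ub) wt_coroot // E8_root_norm // realC2.
  by rewrite scaler_eq0 pnatr_eq0 (negPf u0).
move=> I Ie eI; have [I0|I0] := eqVneq I 0%VS; [by left|right].
have colin b u : Phi b -> u \in W b -> u != 0 -> u \in I -> (W b <= I)%VS.
  move=> rb ub u0 uI; apply/subvP => w wb.
  have [c ->] := W_colinear rb ub u0 wb; exact: memvZ uI.
have [b0 lb0 Wb0] : exists2 b, E8_level R 0 b & (W b <= I)%VS.
  pose v := vpick I.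
  have v0 : v != 0 by rewrite vpick0.
  have vI : v \in I by exact: memv_pick.
  have := subvP e7_sub _ (subvP Ie _ vI); rewrite componentE => /mem_wsumP[x xW vE].
  have sumI : \sum_(b <- [seq b <- all_weights | degree b == 0]) x b \in I by rewrite -vE.
  have xI := e7_components eI xW sumI.
  have [b bs xb0] : exists2 b, b \in [seq b <- all_weights | degree b == 0] & x b != 0.
    apply: contrapT => nob; case/eqP: v0; rewrite vE big1_seq // => b /andP[_ bs].
    by apply: contrapT => xb; apply: nob; exists b => //; apply/eqP.
  have [/eqP lb bw] : degree b == 0 /\ b \in all_weights.
    by move: (bs); rewrite mem_filter => /andP[].
  have [b0|b0] := eqVneq b 0; last first.
    have l0b := level0_neq0 bw lb b0; have rb : Phi b by case: l0b.
    by exists b; [exact: l0b|exact: colin rb (xW b bs) xb0 (xI b bs)].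
  have hT : x b \in T.
    rewrite memv_cap (subvP Ie _ (xI b bs)) /=.
    by have := xW b bs; rewrite {2}b0 wspace0; exact.
  have [hH h1] := (mem_e7_torus _).1 hT.
  have [p p0 wp] : exists2 p : 'I_8, p != ord0 & wt (oct_unit R p) (x b) != 0.
    apply: contrapT => nop; case/eqP: xb0; apply: (H_ext hH (mem0v _)) => p.
    rewrite wt_r0; have [->|p0] := eqVneq p ord0; first exact: h1.
    by apply: contrapT => e; apply: nop; exists p => //; apply/eqP.
  have lp := E8_level_unit R p0; have rp := E8_root_unit R p.
  have [z zp z0] := root_exists rp.
  exists (oct_unit R p); first exact: lp.
  apply: (colin _ z rp zp z0).
  have := eI _ _ (subvP (W_e7 lp) _ zp) (xI b bs).
  rewrite lieC (lieH hH zp) memvN => zI.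
  by have := memvZ (wt (oct_unit R p) (x b))^-1 zI; rewrite scalerA mulVf // scale1r.
have corI a : E8_level R 0 a -> (W a <= I)%VS -> coroot a \in I.
  move=> la WaI; have ra : Phi a by case: la.
  have [u ua u0] := root_exists ra; have [v va ->] := coroot_lie ra ua u0.
  have lNa : E8_level R 0 (- a).
    by case: la => _ /= a0; split; [exact: E8_rootN|rewrite /= oct_innerNl a0 oppr0].
  rewrite lieC memvN.
  exact: eI (subvP (W_e7 lNa) _ va) (subvP WaI _ ua).
have step a b : E8_level R 0 a -> E8_level R 0 b -> oct_inner a b != 0 ->
    (W a <= I)%VS -> (W b <= I)%VS.
  move=> la lb ab WaI; have ra : Phi a by case: la.
  have rb : Phi b by case: lb.
  have [z zb z0] := root_exists rb.
  apply: (colin _ z rb zb z0).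
  have := eI _ _ (subvP (W_e7 lb) _ zb) (corI a la WaI).
  rewrite lieC (lieH (coroot_H ra) zb) memvN wt_coroot // => zI.
  have nz : (oct_inner b a)%:C%C != 0 :> C.
    by rewrite oct_innerC fmorph_eq0.
  by have := memvZ ((oct_inner b a)%:C%C)^-1 zI; rewrite scalerA mulVf // scale1r.
have allI b : E8_level R 0 b -> (W b <= I)%VS.
  by move=> lb; exact: (E7_connected step lb0 lb Wb0).
have TI h : h \in T -> h \in I.
  move=> /mem_e7_torus[hH h1]; rewrite (H_coroots hH).
  apply: memv_suml => p _; have [->|p0] := eqVneq p ord0.
    by rewrite h1 mul0r scale0r mem0v.
  apply: memvZ; have lp := E8_level_unit R p0; exact: corI lp (allI _ lp).
apply/eqP; rewrite eqEsubv Ie /=; apply/subvP => v ve.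
have := subvP e7_sub _ ve; rewrite componentE => /mem_wsumP[x xW vE].
have eqr : bracket_in e7 e7 e7.
  by move=> u w ue; apply: component0_e7; exact: subvP e7_sub _ ue.
have sume : \sum_(b <- [seq b <- all_weights | degree b == 0]) x b \in e7 by rewrite -vE.
have xe := e7_components eqr xW sume.
rewrite vE big_seq; apply: memv_suml => b bs.
have [/eqP lb bw] : degree b == 0 /\ b \in all_weights.
  by move: (bs); rewrite mem_filter => /andP[].
have [b00|b00] := eqVneq b 0.
  apply: TI; rewrite memv_cap (xe b bs) /=.
  by have := xW b bs; rewrite {2}b00 wspace0; exact.
exact: subvP (allI _ (level0_neq0 bw lb b00)) _ (xW b bs).
Qed.

(** Commuting with the coroot of b forces the component at b to vanish. *)
Lemma e7_torus_cartan : cartan_subalgebra e7 T.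
Proof.
case: (cartanH) => _ abH _ _.
split; first exact: capvSl.
- by move=> h k hT kT; exact: abH (e7_torus_H hT) (e7_torus_H kT).
- move=> v ve comm; rewrite memv_cap ve /=.
  have := subvP e7_sub _ ve; rewrite componentE => /mem_wsumP[x].
  set s := filter _ _ => xW vE.
  have us : uniq s by rewrite filter_uniq ?all_weights_uniq.
  rewrite vE big_seq; apply: memv_suml => b bs.
  have [/eqP lb bw] : degree b == 0 /\ b \in all_weights.
    by move: (bs); rewrite mem_filter => /andP[].
  have [b0|b0] := eqVneq b 0; first by have := xW b bs; rewrite {2}b0 wspace0; exact.
  have l0b := level0_neq0 bw lb b0; have rb : Phi b by case: l0b.
  pose y c := wt c (coroot b) *: x c.
  have yW : {in s, forall c, y c \in W c} by move=> c cs; apply: memvZ; exact: xW.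
  have y0 : \sum_(c <- s) y c = 0.
    rewrite -[RHS](comm _ (coroot_e7_torus l0b)) vE [RHS]linear_sum.
    apply: eq_big_seq => c cs.
    by rewrite /= (lieH (coroot_H rb) (xW c cs)).
  have /eqP := W_independent us yW y0 bs.
  rewrite scaler_eq0 wt_coroot // E8_root_norm // realC2 pnatr_eq0 /= => /eqP ->.
  exact: mem0v.
move=> h hT.
pose Y := (vbasis T : seq L) ++ [seq vpick (W b) | b <- E8_level_list R 0].
have YE : <<Y>>%VS = e7.
  rewrite /Y span_cat (span_basis (vbasisP _)).
  apply/eqP; rewrite eqEsubv subv_add capvSl /=; apply/andP; split.
    apply/span_subvP => y /mapP[b /E8_level_listP lb ->].
    exact: subvP (W_e7 lb) _ (memv_pick _).
  apply/subvP => v ve.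
  have := subvP e7_sub _ ve; rewrite componentE => /mem_wsumP[x xW vE].
  have eqr : bracket_in e7 e7 e7.
    by move=> u w ue; apply: component0_e7; exact: subvP e7_sub _ ue.
  have sume : \sum_(b <- [seq b <- all_weights | degree b == 0]) x b \in e7 by rewrite -vE.
  have xe := e7_components eqr xW sume.
  rewrite vE big_seq; apply: memv_suml => b bs.
  have [/eqP lb bw] : degree b == 0 /\ b \in all_weights.
    by move: (bs); rewrite mem_filter => /andP[].
  have [b00|b00] := eqVneq b 0.
    apply: (subvP (addvSl _ _)); rewrite memv_cap (xe b bs) /=.
    by have := xW b bs; rewrite {2}b00 wspace0; exact.
  have l0b := level0_neq0 bw lb b00; have rb : Phi b by case: l0b.
  apply: (subvP (addvSr _ _)).
  have pick0 : vpick (W b) != 0 by rewrite vpick0; exact: W_root.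
  have [c ->] := W_colinear rb (memv_pick _) pick0 (xW b bs).
  apply: memvZ; apply: memv_span; apply: map_f; exact/E8_level_listP.
rewrite -YE; apply: eigenvectors_basis => y; rewrite mem_cat => /orP[yT|/mapP[b _ ->]].
  exists 0; rewrite scale0r; apply/eqP; rewrite -memv0.
  exact: abH (e7_torus_H hT) (e7_torus_H (vbasis_mem yT)).
by exists (wt b h); exact: lieH (e7_torus_H hT) (memv_pick _).
Qed.

End E8Algebra.

Theorem mainTheorem3 (R : realType) :
  let Phi := E8_roots R in
  let alpha := oct_one R in
  let level (p : int) := Phi `&` [set x | oct_inner x alpha = p%:~R] in
  let idempotents := Phi `&` [set x | oct_para x x = x] in
  (* para-octonionic idempotents *)
  [/\ idempotents = [set alpha] `|` level (- 1),
      [set alpha] `&` level (- 1) = set0,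
      level (- 1) #= `I_56
    & idempotents #= `I_57] /\
  (* distribution of the roots relative to alpha *)
  [/\ Phi #= `I_240,
      forall x, Phi x -> exists2 p : int, p \in [:: 2; 1; 0; -1; -2] & level p x,
      [/\ level 2 #= `I_1, level 1 #= `I_56, level 0 #= `I_126,
          level (- 1) #= `I_56 & level (- 2) #= `I_1]
    & root_system_of_type E7_cartan (level 0) (@oct_pairing R)] /\
  (* gradings of e8 *)
  forall (L : lieAlgType R[i]) (H : {vspace L}) (rho : octonion R -> dual_space H),
  e8_with_roots rho ->
  let g := e8_component rho alpha in
  let G := mod3_component g in
  [/\ contact_grading g,
      [/\ \dim (g (- 2)) = 1%N, \dim (g (- 1)) = 56%N, \dim (g 1) = 56%N
        & \dim (g 2) = 1%N]
    & exists (E Z : {vspace L}) (pair : dual_space (E :&: H) -> dual_space (E :&: H) -> R[i]),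
      [/\ [/\ direct_sum2 (g 0) E Z,
              bracket_in (g 0) E E, bracket_in (g 0) Z 0%VS & \dim Z = 1%N],
          simple_of_type E7_cartan E pair,
          minuscule_module E pair (g (- 1)) /\ minuscule_module E pair (g 1)
        & bracket_in E (g (- 2)) 0%VS /\ bracket_in E (g 2) 0%VS]] /\
  [/\ (forall r s : 'Z_3, bracket_in (G r) (G s) (G (r + s))) /\
      direct_sum fullv G,
      G 0 = g 0,
      direct_sum2 (G 1) (g 1) (g (- 2)),
      direct_sum2 (G 2) (g (- 1)) (g 2)
    & root_spaces_in H (G 1) #= `I_57 /\ root_spaces_in H (G 2) #= `I_57].
Proof.
move=> Phi alpha level idempotents.
have levelE p : level p = E8_level R p by [].
have [n2 n1 n0 nm1 nm2] := E8_level_size R.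
have card_level p n : size (E8_level_list R p) = n -> level p #= `I_n.
  by move=> <-; exact: E8_level_card.
have idemE : idempotents = [set alpha] `|` level (- 1).
  apply/seteqP; split=> [x [rx /= xx]|x [->|[rx /= x1]]].
  - have [_ /= nx] := rx; have [->|x1] := (E8_idempotent nx).1 xx; first by left.
    by right; split=> //=; rewrite x1 mulrNz.
  - have r1 := E8_root_one R; have [_ /= nx] := r1.
    by split=> //; apply/(E8_idempotent nx); left.
  - have [_ /= nx] := rx; split=> //; apply/(E8_idempotent nx); right.
    by rewrite x1 mulrNz.
have disj : [set alpha] `&` level (- 1) = set0.
  apply/seteqP; split=> [x [-> [_ /=]]|//].
  by rewrite E8_root_norm ?mulrNz; [lra|exact: E8_root_one].
split; [split=> //; first exact: card_level|split].
- have -> : 57%N = size (alpha :: E8_level_list R (-1)) by rewrite /= nm1.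
  rewrite idemE; apply: card_uniq_seq.
    rewrite cons_uniq E8_level_list_uniq andbT; apply/negP => /E8_level_listP la.
    by have : set0 alpha by rewrite -disj; split.
  move=> x; rewrite inE; split=> [[->|/E8_level_listP ->]|/orP[/eqP->|/E8_level_listP]].
  + by rewrite eqxx.
  + by rewrite orbT.
  + by left.
  + by right.
- split; last exact: E7_level0.
  + by rewrite -(E8_list_size R); exact: card_uniq_seq (E8_list_uniq R) (@E8_listP R).
  + exact: E8_level_values.
  + by split; exact: card_level.
move=> L H rho e8 g G.
have r1 := E8_root_one R.
split; split.
- exact: component_contact.
- by split; rewrite dim_component // ?n2 ?n1 ?nm1 ?nm2.
- exists (e7 rho), (e7_center rho), (@e7_pair _ _ _ rho).
  split.
  + split; [exact: component0_decomposition|exact: component0_e7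
           |exact: component0_center|].
    by rewrite dim_vline (coroot_neq0 _ r1).
  + split; [exact: e7_simple|exact: e7_torus_cartan|exact: e7_root_system].
  + by split; exact: e7_minuscule.
  + by split; [exact: e7_componentN2|exact: e7_component2].
- by split; [exact: mod3_graded|exact: mod3_direct].
- exact: mod3_0.
- exact: mod3_1.
- exact: mod3_2.
- exact: mod3_root_spaces.
Qed.
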